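(* Let $\mathbb{M}=(M_p)_{p\in\mathbb{N}_0}$ be a weight sequence. If $\widetilde{S}_{\mathbb{M}}\neq\emptyset$ (i.e. there is some $\gamma>0$ such that $\widetilde{\mathcal{B}}:\widetilde{\mathcal{A}}_{\mathbb{M}}(S_\gamma)\to\mathbb{C}[[z]]_{\mathbb{M}}$ is surjective), then $\mathbb{M}$ satisfies the strong nonquasianalyticity condition (snq) or, equivalently, $\gamma(\mathbb{M})>0$.
   Context: Sequences. $\mathbb{N}_0=\{0,1,2,\dots\}$. A weight sequence is a sequence $\mathbb{M}=(M_p)_{p\in\mathbb{N}_0}$ of positive reals with $M_0=1$, logarithmically convex ($M_p^2\le M_{p-1}M_{p+1}$ for $p\ge1$), whose sequence of quotients $m_p:=M_{p+1}/M_p$ tends to $\infty$. $\mathbb{M}$ satisfies (snq) if there is $B>0$ with $\sum_{q=p}^\infty\frac{M_q}{(q+1)M_{q+1}}\le B\frac{M_p}{M_{p+1}}$ for all $p\in\mathbb{N}_0$. For $\gamma\in\mathbb{R}$, $\mathbb{M}$ satisfies $(P_\gamma)$ if there are a real sequence $(m'_p)_{p\in\mathbb{N}_0}$ and $a\ge1$ with $a^{-1}m_p\le m'_p\le am_p$ for $p\ge 1$ and $((p+1)^{-\gamma}m'_p)_{p\in\mathbb{N}_0}$ increasing; $\gamma(\mathbb{M}):=\sup\{\gamma\in\mathbb{R}:(P_\gamma)\text{ holds}\}\in[0,\infty]$. (Equivalently, for a weight sequence, $\gamma(\mathbb{M})$ is the supremum, $0$ if the set is empty, of the $\gamma>0$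 for which there is $a>0$ with $m_p/(p+1)^\gamma\le a\,m_q/(q+1)^\gamma$ for all $q\ge p$.) Sectors. $\mathcal{R}$ is the Riemann surface of the logarithm. For $\gamma>0$, $S_\gamma=\{z\in\mathcal{R}:|\arg z|<\gamma\pi/2\}$. A bounded sector $T=\{z\in\mathcal{R}:|\arg z-d|<\alpha\pi/2,\ |z|<r\}$ is a proper subsector of $S_\gamma$, written $T\ll S_\gamma$, if its closure in $\mathcal{R}$ (so the vertex $0$ is not considered) is contained in $S_\gamma$. Classes. $\widetilde{\mathcal{A}}_{\mathbb{M}}(S_\gamma)$ is the space of holomorphic $f:S_\gamma\to\mathbb{C}$ for which there is a (necessarily unique) formal series $\widehat f=\sum_{p\ge0}a_pz^p$ such that for every $T\ll S_\gamma$ there are $C_T,A_T>0$ with $|f(z)-\sum_{n=0}^{p-1}a_nz^n|\le C_TA_T^pM_p|z|^p$ for all $z\in T$, $p\in\mathbb{N}_0$. $\mathbb{C}[[z]]_{\mathbb{M}}$ is the set of $\sum a_pz^p\in\mathbb{C}[[z]]$ for which there is $A>0$ with $\sup_p|a_p|/(A^pM_p)<\infty$. The asymptotic Borel map is $\widetilde{\mathcal{B}}(f)=\widehat f$. $\widetilde{S}_{\mathbb{M}}$ is the set of $\gamma>0$ such that $\widetilde{\mathcal{B}}:\widetilde{\mathcal{A}}_{\mathbb{M}}(S_\gamma)\to\mathbb{C}[[z]]_{\mathbb{M}}$ is surjective. *)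

(* Defs.v *)
From Stdlib Require Import Reals.
From Coquelicot Require Import Coquelicot.
Open Scope R_scope.

(** * Weight sequences *)

Definition quotients (M : nat -> R) (p : nat) : R := M (S p) / M p.

Definition weight_sequence (M : nat -> R) : Prop :=
  (forall p, 0 < M p) /\
  M 0%nat = 1 /\
  (forall p, (1 <= p)%nat -> M p ^ 2 <= M (p - 1)%nat * M (p + 1)%nat) /\
  is_lim_seq (quotients M) p_infty.

(** The sum over [q >= p] is reindexed by [q = p + k]. *)
Definition snq (M : nat -> R) : Prop :=
  exists B : R, 0 < B /\
  forall p : nat,
    ex_series (fun k => M (p + k)%nat / (INR (p + k + 1) * M (p + k + 1)%nat)) /\
    Series (fun k => M (p + k)%nat / (INR (p + k + 1) * M (p + k + 1)%nat))
      <= B * (M p / M (p + 1)%nat).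

(** "Increasing" is meant in the wide sense. The comparison of [m'] with the
    quotients is required for [p >= 1] only, the monotonicity for all [p]. *)
Definition P_index (M : nat -> R) (gamma : R) : Prop :=
  exists (m' : nat -> R) (a : R),
    1 <= a /\
    (forall p, (1 <= p)%nat ->
       / a * quotients M p <= m' p /\ m' p <= a * quotients M p) /\
    (forall p, Rpower (INR (p + 1)) (- gamma) * m' p
               <= Rpower (INR (p + 2)) (- gamma) * m' (p + 1)%nat).

Definition gamma_index (M : nat -> R) : Rbar := Lub_Rbar (P_index M).

(** * The Riemann surface of the logarithm

    It is represented through its global holomorphic chart [log], which maps it
    biholomorphically onto the complex plane: [w : RLog] is the point [z] with
    [log z = w], so that [|z| = exp (Re w)] and [arg z = Im w]. Its topology and
    complex structure are those of [C]; [proj] is the covering map onto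
    [C \ {0}], and a power [z^n] of the coordinate stands for [proj z ^ n]. *)
Definition RLog : Type := C.

Definition rmod (z : RLog) : R := exp (Re z).
Definition rarg (z : RLog) : R := Im z.
Definition proj (z : RLog) : C := (rmod z * cos (rarg z), rmod z * sin (rarg z)).

Definition sector (gamma : R) (z : RLog) : Prop := Rabs (rarg z) < gamma * PI / 2.

Definition bounded_sector (d alpha r : R) (z : RLog) : Prop :=
  Rabs (rarg z - d) < alpha * PI / 2 /\ rmod z < r.

(** Closure in the surface: the vertex 0 is not a point of [RLog]. *)
Definition closure (D : RLog -> Prop) (z : RLog) : Prop :=
  forall U : C -> Prop, locally (T := C_UniformSpace) z U -> exists w, U w /\ D w.

Definition proper_subsector (T : RLog -> Prop) (gamma : R) : Prop :=
  (exists d alpha r, 0 < alpha /\ 0 < r /\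
     forall z, T z <-> bounded_sector d alpha r z) /\
  (forall z, closure T z -> sector gamma z).

(** Functions on a sector are total functions whose values off the sector are
    irrelevant. Complex differentiability is taken in the chart [log]. *)
Definition holomorphic_on (D : RLog -> Prop) (f : RLog -> C) : Prop :=
  forall z, D z -> ex_derive (K := C_AbsRing) (V := C_NormedModule) f z.

(** * Asymptotic expansions and the Borel map

    A formal power series is the sequence of its coefficients. *)

Fixpoint partial_sum (a : nat -> C) (z : C) (p : nat) : C :=
  match p with
  | O => 0%C
  | S n => (partial_sum a z n + a n * Cpow z n)%C
  end.

Definition expansion (M : nat -> R) (gamma : R) (f : RLog -> C) (a : nat -> C)
  : Prop :=
  forall T, proper_subsector T gamma ->
  exists CT AT : R, 0 < CT /\ 0 < AT /\
    forall (z : RLog) (p : nat), T z ->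
      Cmod (f z - partial_sum a (proj z) p)%C <= CT * AT ^ p * M p * rmod z ^ p.

Definition class_A (M : nat -> R) (gamma : R) (f : RLog -> C) : Prop :=
  holomorphic_on (sector gamma) f /\ exists a, expansion M gamma f a.

Definition formal_class (M : nat -> R) (a : nat -> C) : Prop :=
  exists A : R, 0 < A /\ exists K : R, forall p, Cmod (a p) / (A ^ p * M p) <= K.

(** Graph of the asymptotic Borel map on [class_A M gamma]; it is single-valued
    because the expansion of a function is unique. *)
Definition borel (M : nat -> R) (gamma : R) (f : RLog -> C) (a : nat -> C) : Prop :=
  class_A M gamma f /\ expansion M gamma f a.

Definition borel_surjective (M : nat -> R) (gamma : R) : Prop :=
  forall a, formal_class M a -> exists f, borel M gamma f a.

Definition S_tilde (M : nat -> R) (gamma : R) : Prop :=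
  0 < gamma /\ borel_surjective M gamma.

(* Main.v *)
(** Write [m] for the quotients of [M]. Both (snq) and [gamma(M) > 0] say that
    [2 m_p <= m_(N p)] for some [N] and all large [p]. If this fails, there are
    [p_k] and [N_k] tending to infinity with [m_(N_k p_k) < 2 m_(p_k)] and
    [N_k p_k <= p_(k+1)]. Let [f] have the lacunary expansion
    [sum_k M_(2 p_k) z^(2 p_k)]. For [p = p_k], the remainder [F] of order [2 p + 1]
    is at most [c 2^(- N_k p)] for [|z| <= delta / m_p], by the remainder estimate of
    order [N_k p], and at most [c Q^p] for [|z| <= 2 K / m_p], where
    [c = M_p m_p^(-p)] and [delta], [K], [Q] do not depend on [k]. At
    [z = K / m_p], however, the remainder of order [p] is too small to contain the
    term [M_(2 p) z^(2 p)], so [|F| >= c / 2] there. For large [N_k] this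
    contradicts the two-constants theorem, applied in a rectangle of the
    logarithmic chart. *)
Require Import Defs.
From Stdlib Require Import Reals Lra Lia Psatz Classical ClassicalEpsilon.
From Coquelicot Require Import Coquelicot.
Open Scope R_scope.

(** * Cauchy's theorem on rectangles *)

(** Failure of growth makes the weight almost geometric on a long stretch: the quotients from [p] to
    [N p] lie between [m_p] and [2 m_p], so for [p <= n <= N p] the number [M_n] lies between
    [M_p m_p^(n - p)] and [2^(n - p)] times it. In the variable [m_p z] the bounds, relative to [c],
    involve only powers with exponents [p] and [N p], so one rectangle of the chart, translated by
    [ln m_p], serves for every [p]. The exponent [2 p] is strictly inside the stretch. The remainder
    of order [p] is at most [c CT (A K)^p] while the isolated term is at least [c K^(2 p)], so a
    radius [K] that is large compared with [A] makes the term win, and [F] is there essentially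
    minus the term. The remainder of order [N p] has the term already removed, whence the smallness
    at the radius [delta]. The opening of the sector enters only through the height of the
    rectangle, hence through the constants of the two-constants theorem. These are fixed before [N]
    and [p]: a thin rectangle makes the interpolation poor, but a large [N] compensates for it.
    Therefore every positive opening is enough. *)

(** The target is the ring [C_AbsRing] itself, so that Coquelicot's rules for
    products and compositions apply; [Cdiff_of_ex_derive] bridges the gap to
    [C_NormedModule]. *)
Definition Cdiff (f : C -> C) (z : C) : Prop :=
  ex_derive (K := C_AbsRing) (V := AbsRing_NormedModule C_AbsRing) f z.

(** The epsilon form no longer mentions a module structure on the target, so derivatives taken in
    [C_NormedModule] and in [C_AbsRing] meet in it. *)
Lemma Cdiff_eps (f : C -> C) (z : C) :
  Cdiff f z <-> exists l : C, forall eps : R, 0 < eps -> exists d : R, 0 < d /\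
    forall w : C, Cmod (w - z) < d ->
      Cmod (f w - f z - (w - z) * l)%C <= eps * Cmod (w - z).
Proof.
  split.
  - intros [l [_ H]]. exists l. intros eps Heps.
    destruct (H z (fun P HP => HP) (mkposreal eps Heps)) as [d Hd].
    exists d. split. { apply cond_pos. }
    intros w Hw. exact (Hd w Hw).
  - intros [l H]. exists l. split.
    { apply (is_linear_scal_l (K := C_AbsRing) (V := AbsRing_NormedModule C_AbsRing)). }
    intros x Hx.
    rewrite <- (is_filter_lim_locally_unique _ _ Hx).
    intros eps. destruct (H eps (cond_pos eps)) as [d [Hd Hw]].
    exists (mkposreal d Hd). intros w Hb. exact (Hw w Hb).
Qed.

Lemma Cdiff_of_ex_derive (f : C -> C) (z : C) :
  ex_derive (K := C_AbsRing) (V := C_NormedModule) f z -> Cdiff f z.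
Proof.
  intros [l [_ H]]. apply Cdiff_eps. exists l. intros eps Heps.
  destruct (H z (fun P HP => HP) (mkposreal eps Heps)) as [d Hd].
  exists d. split. { apply cond_pos. }
  intros w Hw. exact (Hd w Hw).
Qed.

Lemma Cdiff_mult (f g : C -> C) (z : C) :
  Cdiff f z -> Cdiff g z -> Cdiff (fun w => f w * g w)%C z.
Proof.
  intros [l Hl] [k Hk]. eexists.
  apply (is_derive_mult (K := C_AbsRing) f g z l k Hl Hk). apply Cmult_comm.
Qed.

Lemma Cdiff_comp (f g : C -> C) (z : C) :
  Cdiff f (g z) -> Cdiff g z -> Cdiff (fun w => f (g w)) z.
Proof.
  intros [l Hl] [k Hk]. eexists.
  apply (is_derive_comp (K := C_AbsRing) (V := AbsRing_NormedModule C_AbsRing) f g z l k Hl Hk).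
Qed.

Lemma Cdiff_minus (f g : C -> C) (z : C) :
  Cdiff f z -> Cdiff g z -> Cdiff (fun w => f w - g w)%C z.
Proof.
  intros Hf Hg.
  apply (ex_derive_minus (K := C_AbsRing) (V := AbsRing_NormedModule C_AbsRing) f g z Hf Hg).
Qed.

Lemma Cdiff_plus (f g : C -> C) (z : C) :
  Cdiff f z -> Cdiff g z -> Cdiff (fun w => f w + g w)%C z.
Proof.
  intros Hf Hg.
  apply (ex_derive_plus (K := C_AbsRing) (V := AbsRing_NormedModule C_AbsRing) f g z Hf Hg).
Qed.

Lemma Cdiff_const (c z : C) : Cdiff (fun _ => c) z.
Proof.
  apply (ex_derive_const (K := C_AbsRing) (V := AbsRing_NormedModule C_AbsRing) c z).
Qed.

Lemma Cdiff_id (z : C) : Cdiff (fun w => w) z.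
Proof. apply (ex_derive_id (K := C_AbsRing) z). Qed.

Lemma Cdiff_cont (f : C -> C) (z : C) : Cdiff f z ->
  forall eps : R, 0 < eps -> exists d : R, 0 < d /\
    forall w : C, Cmod (w - z) < d -> Cmod (f w - f z) < eps.
Proof.
  intros H eps Heps. apply Cdiff_eps in H. destruct H as [l H].
  destruct (H 1 Rlt_0_1) as [d [Hd Hw]].
  pose proof (Cmod_ge_0 l) as Hl.
  assert (Hq : 0 < eps / (2 + Cmod l)) by (apply Rdiv_lt_0_compat; lra).
  exists (Rmin d (eps / (2 + Cmod l))). split. { now apply Rmin_pos. }
  intros w Hwd.
  assert (H1 := Hw w (Rlt_le_trans _ _ _ Hwd (Rmin_l _ _))).
  assert (H2 := Rlt_le_trans _ _ _ Hwd (Rmin_r _ _)).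
  replace (f w - f z)%C with ((f w - f z - (w - z) * l) + (w - z) * l)%C by ring.
  eapply Rle_lt_trans. { apply Cmod_triangle. }
  rewrite Cmod_mult. pose proof (Cmod_ge_0 (w - z)).
  apply Rle_lt_trans with ((2 + Cmod l) * Cmod (w - z)).
  { nra. }
  apply Rmult_lt_compat_l with (r := 2 + Cmod l) in H2; [|lra].
  replace ((2 + Cmod l) * (eps / (2 + Cmod l))) with eps in H2 by (field; lra).
  lra.
Qed.

Lemma Cdiff_inv (z : C) : z <> 0%C -> Cdiff (fun w => / w)%C z.
Proof.
  intros Hz. apply Cdiff_eps. exists (- / (z * z))%C. intros eps Heps.
  assert (Hm : 0 < Cmod z) by now apply Cmod_gt_0.
  set (r := Cmod z) in *.
  assert (Hq : 0 < eps * (r * r * r) / 2).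
  { apply Rdiv_lt_0_compat; [|lra]. auto using Rmult_lt_0_compat. }
  (* The first bound keeps [Cmod w] at least [r / 2]; the second then makes the quadratic error
     [t * t / (s * (r * r))] at most [eps * t]. *)
  exists (Rmin (r / 2) (eps * (r * r * r) / 2)). split. { apply Rmin_pos; lra. }
  intros w Hw.
  assert (H1 := Rlt_le_trans _ _ _ Hw (Rmin_l _ _)).
  assert (H2 := Rlt_le_trans _ _ _ Hw (Rmin_r _ _)).
  assert (Hwr : r / 2 <= Cmod w).
  { pose proof (Cmod_triangle w (z - w)) as Ht.
    replace (w + (z - w))%C with z in Ht by ring.
    replace (z - w)%C with (- (w - z))%C in Ht by ring.
    rewrite Cmod_opp in Ht. fold r in Ht. lra. }
  assert (Hw0 : w <> 0%C). { apply Cmod_gt_0. lra. }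
  replace (/ w - / z - (w - z) * - / (z * z))%C
    with ((w - z) * (w - z) * / (w * (z * z)))%C by (field; auto).
  rewrite !Cmod_mult, Cmod_inv, !Cmod_mult; fold r.
  2:{ repeat apply Cmult_neq_0; auto. }
  pose proof (Cmod_ge_0 (w - z)) as H0. set (t := Cmod (w - z)) in *.
  set (s := Cmod w) in *.
  assert (Hs : 0 < s) by lra.
  assert (Hrr : 0 < r * r) by now apply Rmult_lt_0_compat.
  assert (Hp : 0 < s * (r * r)) by now apply Rmult_lt_0_compat.
  assert (t * / (s * (r * r)) <= eps).
  { apply Rmult_le_reg_r with (s * (r * r)); [easy|].
    rewrite Rmult_assoc, Rinv_l by lra.
    apply Rle_trans with (eps * (r * r) * (r / 2)); [lra|].
    replace (t * 1) with t by ring.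
    replace (eps * (s * (r * r))) with (eps * (r * r) * s) by ring.
    apply Rmult_le_compat_l; [|easy].
    apply Rlt_le; now apply Rmult_lt_0_compat. }
  rewrite (Rmult_assoc t t), (Rmult_comm t (_ * _)).
  now apply Rmult_le_compat_r.
Qed.

(** * Integrals along the boundary of a rectangle *)

Lemma continuous_C_eps (g : R -> C) (x : R) :
  (forall eps : R, 0 < eps -> exists d : R, 0 < d /\
    forall t : R, Rabs (t - x) < d -> Cmod (g t - g x) < eps) ->
  continuous (T := R_UniformSpace) (U := C_R_CompleteNormedModule) g x.
Proof.
  intros H. apply filterlim_locally. intros eps.
  destruct (H eps (cond_pos eps)) as [d [Hd Hw]].
  exists (mkposreal d Hd). intros t Ht.
  apply (C_NormedModule_mixin_compat1 (g x) (g t) eps). exact (Hw t Ht).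
Qed.

Lemma Cmod_pair_le (x y : R) : Cmod (x, y) <= Rabs x + Rabs y.
Proof.
  replace (x, y) with (RtoC x + Ci * RtoC y)%C
    by (apply injective_projections; cbn; ring).
  eapply Rle_trans. { apply Cmod_triangle. }
  rewrite Cmod_mult, Cmod_Ci, !Cmod_R. lra.
Qed.

Lemma ex_RInt_horizontal (f : C -> C) (a b y : R) : a <= b ->
  (forall x, a <= x <= b -> Cdiff f (x, y)) ->
  ex_RInt (V := C_R_CompleteNormedModule) (fun t => f (t, y)) a b.
Proof.
  intros Hab H. apply (ex_RInt_continuous (V := C_R_CompleteNormedModule)).
  intros x Hx. rewrite Rmin_left, Rmax_right in Hx by lra.
  apply continuous_C_eps. intros eps Heps.
  destruct (Cdiff_cont f (x, y) (H x Hx) eps Heps) as [d [Hd Hw]].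
  exists d. split; [lra|]. intros t Ht. apply Hw.
  replace ((t, y) - (x, y))%C with (RtoC (t - x))
    by (apply injective_projections; cbn; ring).
  now rewrite Cmod_R.
Qed.

Lemma ex_RInt_vertical (f : C -> C) (c d x : R) : c <= d ->
  (forall y, c <= y <= d -> Cdiff f (x, y)) ->
  ex_RInt (V := C_R_CompleteNormedModule) (fun t => f (x, t)) c d.
Proof.
  intros Hab H. apply (ex_RInt_continuous (V := C_R_CompleteNormedModule)).
  intros y Hy. rewrite Rmin_left, Rmax_right in Hy by lra.
  apply continuous_C_eps. intros eps Heps.
  destruct (Cdiff_cont f (x, y) (H y Hy) eps Heps) as [e [He Hw]].
  exists e. split; [lra|]. intros t Ht. apply Hw.
  replace ((x, t) - (x, y))%C with (Ci * RtoC (t - y))%C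
    by (apply injective_projections; cbn; ring).
  now rewrite Cmod_mult, Cmod_Ci, Cmod_R, Rmult_1_l.
Qed.

(** The integral of [f] along the boundary of [[a, b] x [c, d]], taken
    counterclockwise. *)
Definition rect_int (f : C -> C) (a b c d : R) : C :=
  (RInt (V := C_R_CompleteNormedModule) (fun t => f (t, c)) a b
   - RInt (V := C_R_CompleteNormedModule) (fun t => f (t, d)) a b
   + Ci * (RInt (V := C_R_CompleteNormedModule) (fun t => f (b, t)) c d
           - RInt (V := C_R_CompleteNormedModule) (fun t => f (a, t)) c d))%C.

Definition edges_integrable (f : C -> C) (a b c d : R) : Prop :=
  (ex_RInt (V := C_R_CompleteNormedModule) (fun t => f (t, c)) a b /\
   ex_RInt (V := C_R_CompleteNormedModule) (fun t => f (t, d)) a b) /\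
  (ex_RInt (V := C_R_CompleteNormedModule) (fun t => f (b, t)) c d /\
   ex_RInt (V := C_R_CompleteNormedModule) (fun t => f (a, t)) c d).

Lemma edges_integrable_Cdiff (f : C -> C) (a b c d : R) : a <= b -> c <= d ->
  (forall x y, a <= x <= b -> c <= y <= d ->
     (x = a \/ x = b) \/ (y = c \/ y = d) -> Cdiff f (x, y)) ->
  edges_integrable f a b c d.
Proof.
  intros Hab Hcd H. repeat split.
  - apply ex_RInt_horizontal; auto. intros; apply H; auto; lra.
  - apply ex_RInt_horizontal; auto. intros; apply H; auto; lra.
  - apply ex_RInt_vertical; auto. intros; apply H; auto; lra.
  - apply ex_RInt_vertical; auto. intros; apply H; auto; lra.
Qed.

(** The two integrals along the common edge at [m] cancel, and the horizontal ones concatenate. *)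
Lemma rect_int_split_x (f : C -> C) (a m b c d : R) :
  edges_integrable f a m c d -> edges_integrable f m b c d ->
  rect_int f a b c d = (rect_int f a m c d + rect_int f m b c d)%C.
Proof.
  intros [[H1 H2] _] [[H3 H4] _]. unfold rect_int.
  rewrite <- (RInt_Chasles _ _ _ _ H1 H3), <- (RInt_Chasles _ _ _ _ H2 H4).
  change (@plus C_R_CompleteNormedModule) with Cplus.
  ring.
Qed.

Lemma rect_int_split_y (f : C -> C) (a b c m d : R) :
  edges_integrable f a b c m -> edges_integrable f a b m d ->
  rect_int f a b c d = (rect_int f a b c m + rect_int f a b m d)%C.
Proof.
  intros [_ [H1 H2]] [_ [H3 H4]]. unfold rect_int.
  rewrite <- (RInt_Chasles _ _ _ _ H1 H3), <- (RInt_Chasles _ _ _ _ H2 H4).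
  change (@plus C_R_CompleteNormedModule) with Cplus.
  ring.
Qed.

Lemma norm_C_R (z : C) : norm (V := C_R_NormedModule) z = Cmod z.
Proof.
  change (sqrt (Rabs (fst z) ^ 2 + Rabs (snd z) ^ 2) = Cmod z).
  now rewrite !pow2_abs.
Qed.

Lemma Cmod_RInt_le (g : R -> C) (a b B : R) : a <= b ->
  ex_RInt (V := C_R_CompleteNormedModule) g a b ->
  (forall x, a <= x <= b -> Cmod (g x) <= B) ->
  Cmod (RInt (V := C_R_CompleteNormedModule) g a b) <= (b - a) * B.
Proof.
  intros Hab H HB.
  rewrite <- norm_C_R.
  apply (norm_RInt_le_const (V := C_R_NormedModule) g a b _ B Hab).
  - intros x Hx. rewrite norm_C_R. now apply HB.
  - exact (RInt_correct (V := C_R_CompleteNormedModule) g a b H).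
Qed.

Lemma rect_int_bound (f : C -> C) (a b c d B : R) :
  a <= b -> c <= d -> edges_integrable f a b c d ->
  (forall x y, a <= x <= b -> c <= y <= d ->
     (x = a \/ x = b) \/ (y = c \/ y = d) -> Cmod (f (x, y)) <= B) ->
  Cmod (rect_int f a b c d) <= 2 * ((b - a) + (d - c)) * B.
Proof.
  intros Hab Hcd [[H1 H2] [H3 H4]] HB. unfold rect_int.
  assert (K1 := Cmod_RInt_le _ _ _ B Hab H1
    (fun x Hx => HB x c ltac:(lra) ltac:(lra) ltac:(auto))).
  assert (K2 := Cmod_RInt_le _ _ _ B Hab H2
    (fun x Hx => HB x d ltac:(lra) ltac:(lra) ltac:(auto))).
  assert (K3 := Cmod_RInt_le _ _ _ B Hcd H3
    (fun x Hx => HB b x ltac:(lra) ltac:(lra) ltac:(auto))).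
  assert (K4 := Cmod_RInt_le _ _ _ B Hcd H4
    (fun x Hx => HB a x ltac:(lra) ltac:(lra) ltac:(auto))).
  assert (Hm : forall u v : C, Cmod (u - v) <= Cmod u + Cmod v).
  { intros u v. rewrite <- (Cmod_opp v). apply Cmod_triangle. }
  eapply Rle_trans. { apply Cmod_triangle. }
  rewrite Cmod_mult, Cmod_Ci.
  eapply Rle_trans. { apply Rplus_le_compat; [apply Hm|]. apply Rmult_le_compat_l; [lra|apply Hm]. }
  lra.
Qed.

Lemma rect_int_minus (f g : C -> C) (a b c d : R) :
  edges_integrable f a b c d -> edges_integrable g a b c d ->
  edges_integrable (fun w => f w - g w)%C a b c d /\
  rect_int (fun w => f w - g w)%C a b c d
  = (rect_int f a b c d - rect_int g a b c d)%C.
Proof.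
  intros [[H1 H2] [H3 H4]] [[K1 K2] [K3 K4]]. split.
  - repeat split;
      apply (ex_RInt_minus (V := C_R_NormedModule)); assumption.
  - assert (E : forall u v a b, ex_RInt (V := C_R_CompleteNormedModule) u a b ->
      ex_RInt (V := C_R_CompleteNormedModule) v a b ->
      RInt (V := C_R_CompleteNormedModule) (fun t => u t - v t)%C a b
      = (RInt (V := C_R_CompleteNormedModule) u a b
         - RInt (V := C_R_CompleteNormedModule) v a b)%C).
    { intros u v p q Hu Hv. exact (RInt_minus (V := C_R_CompleteNormedModule) u v p q Hu Hv). }
    unfold rect_int. rewrite !E by assumption. ring.
Qed.

Lemma is_RInt_affine (p q a b : R) :
  is_RInt (fun t => p + q * t) a b (p * (b - a) + q * (b * b - a * a) / 2).
Proof.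
  replace (p * (b - a) + q * (b * b - a * a) / 2)
    with (minus ((fun t => p * t + q * (t * t) / 2) b) ((fun t => p * t + q * (t * t) / 2) a))
    by (unfold minus, plus, opp; cbn; field).
  apply (is_RInt_derive (fun t => p * t + q * (t * t) / 2)).
  - intros x _. auto_derive; [easy|field].
  - intros x _. apply (ex_derive_continuous (fun t => p + q * t)). auto_derive. easy.
Qed.

Lemma RInt_affine_C (g : R -> C) (p q p' q' a b : R) :
  (forall t, g t = (p + q * t, p' + q' * t)) ->
  RInt (V := C_R_CompleteNormedModule) g a b
  = (p * (b - a) + q * (b * b - a * a) / 2, p' * (b - a) + q' * (b * b - a * a) / 2).
Proof.
  intros Hg. apply is_RInt_unique.
  apply (is_RInt_fct_extend_pair (U := R_NormedModule) (V := R_NormedModule)).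
  - eapply is_RInt_ext; [|apply is_RInt_affine].
    intros t _. cbn. rewrite Hg. reflexivity.
  - eapply is_RInt_ext; [|apply is_RInt_affine].
    intros t _. cbn. rewrite Hg. reflexivity.
Qed.

(** Cauchy's theorem for the linear approximation that [goursat_rect] subtracts, by explicit
    integration of both coordinates along the edges. *)
Lemma rect_int_affine (al be z : C) (a b c d : R) :
  rect_int (fun w => al + (w - z) * be)%C a b c d = 0%C.
Proof.
  destruct al as [a1 a2], be as [b1 b2], z as [z1 z2]. unfold rect_int.
  rewrite (RInt_affine_C (fun t => (a1, a2) + ((t, c) - (z1, z2)) * (b1, b2))%C
    (a1 - z1 * b1 - (c - z2) * b2) b1 (a2 - z1 * b2 + (c - z2) * b1) b2)
    by (intros; apply injective_projections; cbn; ring).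
  rewrite (RInt_affine_C (fun t => (a1, a2) + ((t, d) - (z1, z2)) * (b1, b2))%C
    (a1 - z1 * b1 - (d - z2) * b2) b1 (a2 - z1 * b2 + (d - z2) * b1) b2)
    by (intros; apply injective_projections; cbn; ring).
  rewrite (RInt_affine_C (fun t => (a1, a2) + ((b, t) - (z1, z2)) * (b1, b2))%C
    (a1 + (b - z1) * b1 + z2 * b2) (- b2) (a2 + (b - z1) * b2 - z2 * b1) b1)
    by (intros; apply injective_projections; cbn; ring).
  rewrite (RInt_affine_C (fun t => (a1, a2) + ((a, t) - (z1, z2)) * (b1, b2))%C
    (a1 + (a - z1) * b1 + z2 * b2) (- b2) (a2 + (a - z1) * b2 - z2 * b1) b1)
    by (intros; apply injective_projections; cbn; ring).
  apply injective_projections; cbn; field.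
Qed.

(** * Goursat's bisection argument *)

Lemma nested_intervals_point (l r : nat -> R) :
  (forall n, l n <= l (S n)) -> (forall n, r (S n) <= r n) ->
  (forall n, l n <= r n) -> exists u, forall n, l n <= u <= r n.
Proof.
  intros Hl Hr Hlr.
  assert (Hlm : forall n k, l n <= l (n + k)%nat).
  { intros n k. induction k as [|k IH]; [rewrite Nat.add_0_r; lra|].
    rewrite Nat.add_succ_r. pose proof (Hl (n + k)%nat). lra. }
  assert (Hrm : forall n k, r (n + k)%nat <= r n).
  { intros n k. induction k as [|k IH]; [rewrite Nat.add_0_r; lra|].
    rewrite Nat.add_succ_r. pose proof (Hr (n + k)%nat). lra. }
  assert (Hx : forall n k, l n <= r k).
  { intros n k. pose proof (Hlm n k). pose proof (Hrm k n).
    rewrite Nat.add_comm in H0. pose proof (Hlr (n + k)%nat). lra. }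
  destruct (completeness (fun x => exists n, x = l n)) as [u [Hu1 Hu2]].
  - exists (r 0%nat). intros x [n ->]. apply Hx.
  - exists (l 0%nat). now exists 0%nat.
  - exists u. intros n. split.
    + apply Hu1. now exists n.
    + apply Hu2. intros x [k ->]. apply Hx.
Qed.

Lemma half_pow_small (K eps : R) : 0 < eps -> exists n, K / 2 ^ n < eps.
Proof.
  intros Heps.
  assert (H1 : Rabs (/ 2) < 1) by (rewrite Rabs_pos_eq; lra).
  assert (Hq : 0 < eps / (Rabs K + 1)).
  { apply Rdiv_lt_0_compat; pose proof (Rabs_pos K); lra. }
  destruct (pow_lt_1_zero (/ 2) H1 _ Hq) as [n Hn].
  exists n. specialize (Hn n (le_n n)).
  rewrite pow_inv in Hn.
  assert (H2 : 0 < / 2 ^ n) by (apply Rinv_0_lt_compat, pow_lt; lra).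
  rewrite (Rabs_pos_eq (/ 2 ^ n)) in Hn by lra.
  pose proof (Rabs_pos K). pose proof (Rle_abs K).
  apply Rmult_lt_compat_l with (r := Rabs K + 1) in Hn; [|lra].
  replace ((Rabs K + 1) * (eps / (Rabs K + 1))) with eps in Hn by (field; lra).
  unfold Rdiv. nra.
Qed.

Definition Cdiff_rect (f : C -> C) (a b c d : R) : Prop :=
  forall x y, a <= x <= b -> c <= y <= d -> Cdiff f (x, y).

Lemma edges_integrable_rect (f : C -> C) (a b c d a' b' c' d' : R) :
  Cdiff_rect f a b c d -> a <= a' <= b' -> b' <= b -> c <= c' <= d' -> d' <= d ->
  edges_integrable f a' b' c' d'.
Proof.
  intros H Ha Hb Hc Hd. apply edges_integrable_Cdiff; try lra.
  intros x y Hx Hy _. apply H; lra.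
Qed.

(** The integrals over the four quarters add up to the whole one, so they cannot all be at most [e].
    With a corner and side lengths as data, choosing a quarter is choosing a corner. *)
Lemma small_quarter (f : C -> C) (a b c d x y X Y e : R) :
  Cdiff_rect f a b c d -> a <= x -> 0 <= X -> x + 2 * X <= b ->
  c <= y -> 0 <= Y -> y + 2 * Y <= d ->
  4 * e < Cmod (rect_int f x (x + 2 * X) y (y + 2 * Y)) ->
  exists x' y', (x' = x \/ x' = x + X) /\ (y' = y \/ y' = y + Y) /\
    e < Cmod (rect_int f x' (x' + X) y' (y' + Y)).
Proof.
  intros Hf H1 H2 H3 H4 H5 H6 H.
  assert (E : forall u v p q, a <= u <= v -> v <= b -> c <= p <= q -> q <= d ->
    edges_integrable f u v p q).
  { intros; apply (edges_integrable_rect f a b c d); auto. }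
  rewrite (rect_int_split_x f x (x + X)) in H by (apply E; lra).
  rewrite (rect_int_split_y f x (x + X) y (y + Y)) in H by (apply E; lra).
  rewrite (rect_int_split_y f (x + X) (x + 2 * X) y (y + Y)) in H by (apply E; lra).
  replace (x + 2 * X) with ((x + X) + X) in H by ring.
  replace (y + 2 * Y) with ((y + Y) + Y) in H by ring.
  set (I1 := rect_int f x (x + X) y (y + Y)) in *.
  set (I2 := rect_int f x (x + X) (y + Y) (y + Y + Y)) in *.
  set (I3 := rect_int f (x + X) (x + X + X) y (y + Y)) in *.
  set (I4 := rect_int f (x + X) (x + X + X) (y + Y) (y + Y + Y)) in *.
  destruct (Rlt_dec e (Cmod I1)) as [L1|L1]. { exists x, y. tauto. }
  destruct (Rlt_dec e (Cmod I2)) as [L2|L2]. { exists x, (y + Y). tauto. }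
  destruct (Rlt_dec e (Cmod I3)) as [L3|L3]. { exists (x + X), y. tauto. }
  destruct (Rlt_dec e (Cmod I4)) as [L4|L4]. { exists (x + X), (y + Y). tauto. }
  exfalso.
  pose proof (Cmod_triangle (I1 + I2) (I3 + I4)).
  pose proof (Cmod_triangle I1 I2). pose proof (Cmod_triangle I3 I4). lra.
Qed.

Lemma goursat_rect (f : C -> C) (a b c d : R) : a <= b -> c <= d ->
  Cdiff_rect f a b c d -> rect_int f a b c d = 0%C.
Proof.
  intros Hab Hcd Hf. apply Cmod_eq_0.
  apply Rle_antisym; [|apply Cmod_ge_0]. apply Rnot_lt_le. intros Hpos.
  set (I := Cmod (rect_int f a b c d)) in *.
  (* Half of [I] makes the strict inequality in [bad] true at stage [0]. *)
  set (e := I / 2). set (X := b - a). set (Y := d - c).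
  assert (HX : 0 <= X) by (unfold X; lra).
  assert (HY : 0 <= Y) by (unfold Y; lra).
  assert (Hp2 : forall n, 0 < 2 ^ n) by (intros; apply pow_lt; lra).
  pose (bad := fun n (p : R * R) => a <= fst p /\ fst p + X / 2 ^ n <= b /\
    c <= snd p /\ snd p + Y / 2 ^ n <= d /\
    e / 4 ^ n < Cmod (rect_int f (fst p) (fst p + X / 2 ^ n) (snd p) (snd p + Y / 2 ^ n))).
  assert (Hhalf : forall Z n, Z / 2 ^ n = 2 * (Z / 2 ^ S n)).
  { intros Z n. cbn. pose proof (Hp2 n). field. lra. }
  assert (Hge : forall Z n, 0 <= Z -> 0 <= Z / 2 ^ n).
  { intros Z n HZ. apply Rdiv_le_0_compat; auto. }
  (* The hypothesis [bad n p] stays under the existential, so that choice yields a total function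
     [next] which can be iterated. *)
  assert (Hstep : forall n p, exists q, bad n p -> bad (S n) q /\
    fst p <= fst q /\ fst q + X / 2 ^ S n <= fst p + X / 2 ^ n /\
    snd p <= snd q /\ snd q + Y / 2 ^ S n <= snd p + Y / 2 ^ n).
  { intros n [x y].
    destruct (classic (bad n (x, y))) as [(B1 & B2 & B3 & B4 & B5)|NB];
      [|exists (x, y); tauto]. cbn [fst snd] in *.
    pose proof (Hge X (S n) HX) as GX. pose proof (Hge Y (S n) HY) as GY.
    rewrite (Hhalf X n), (Hhalf Y n) in *.
    destruct (small_quarter f a b c d x y (X / 2 ^ S n) (Y / 2 ^ S n) (e / 4 ^ S n))
      as (x' & y' & Hx & Hy & Hc); auto.
    { replace (4 * (e / 4 ^ S n)) with (e / 4 ^ n); auto. cbn.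
      assert (0 < 4 ^ n) by (apply pow_lt; lra). field. lra. }
    exists (x', y'). intros _. unfold bad. cbn [fst snd].
    destruct Hx as [-> | ->], Hy as [-> | ->]; repeat split; auto; lra. }
  assert (Hch : exists next : nat -> R * R -> R * R, forall n p, bad n p -> bad (S n) (next n p) /\
    fst p <= fst (next n p) /\ fst (next n p) + X / 2 ^ S n <= fst p + X / 2 ^ n /\
    snd p <= snd (next n p) /\ snd (next n p) + Y / 2 ^ S n <= snd p + Y / 2 ^ n).
  { exists (fun n p => proj1_sig (constructive_indefinite_description _ (Hstep n p))).
    intros n p. exact (proj2_sig (constructive_indefinite_description _ (Hstep n p))). }
  destruct Hch as [next Hnext].
  pose (s := fix s n := match n with O => (a, c) | S k => next k (s k) end).
  assert (Hs : forall n, bad n (s n)).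
  { induction n as [|n IH].
    - unfold bad; cbn. unfold Rdiv. rewrite !Rinv_1, !Rmult_1_r.
      unfold X, Y. replace (a + (b - a)) with b by ring.
      replace (c + (d - c)) with d by ring. fold I. unfold e. repeat split; lra.
    - apply (Hnext n (s n) IH). }
  destruct (nested_intervals_point (fun n => fst (s n)) (fun n => fst (s n) + X / 2 ^ n)) as [u Hu].
  { intros n. apply (Hnext n (s n) (Hs n)). }
  { intros n. apply (Hnext n (s n) (Hs n)). }
  { intros n. pose proof (Hge X n HX). lra. }
  destruct (nested_intervals_point (fun n => snd (s n)) (fun n => snd (s n) + Y / 2 ^ n)) as [v Hv].
  { intros n. apply (Hnext n (s n) (Hs n)). }
  { intros n. apply (Hnext n (s n) (Hs n)). }
  { intros n. pose proof (Hge Y n HY). lra. }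
  assert (Huv : Cdiff f (u, v)).
  { apply Hf.
    - pose proof (Hu 0%nat) as H0. cbn in H0. unfold X in H0. lra.
    - pose proof (Hv 0%nat) as H0. cbn in H0. unfold Y in H0. lra. }
  apply Cdiff_eps in Huv. destruct Huv as [l Hl].
  (* At stage [n] perimeter times diameter is at most [K / 4 ^ n]. A linearization error with slope
     [e / (K + 1)] thus integrates to at most [K / (K + 1) * (e / 4 ^ n)], which is below the bound
     kept in [bad]. *)
  set (K := 2 * (X + Y) * (X + Y)).
  assert (HK : 0 <= K) by (unfold K; nra).
  assert (He : 0 < e) by (unfold e; lra).
  destruct (Hl (e / (K + 1))) as [dl [Hdl Hw]]. { apply Rdiv_lt_0_compat; lra. }
  destruct (half_pow_small (X + Y) dl Hdl) as [n Hn].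
  destruct (Hs n) as (B1 & B2 & B3 & B4 & B5).
  specialize (Hu n). specialize (Hv n). cbn beta in Hu, Hv.
  set (x := fst (s n)) in *. set (y := snd (s n)) in *. clearbody x y.
  pose proof (Hge X n HX) as GX. pose proof (Hge Y n HY) as GY.
  set (Xn := X / 2 ^ n) in *. set (Yn := Y / 2 ^ n) in *.
  assert (ES : (X + Y) / 2 ^ n = Xn + Yn) by (unfold Xn, Yn, Rdiv; ring).
  rewrite ES in Hn.
  assert (EI : edges_integrable f x (x + Xn) y (y + Yn)).
  { apply (edges_integrable_rect f a b c d); auto; lra. }
  assert (EA : edges_integrable (fun w => f (u, v) + (w - (u, v)) * l)%C x (x + Xn) y (y + Yn)).
  { apply edges_integrable_Cdiff; try lra. intros p q _ _ _.
    apply Cdiff_plus; [apply Cdiff_const|].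
    apply Cdiff_mult; [|apply Cdiff_const].
    apply Cdiff_minus; [apply Cdiff_id | apply Cdiff_const]. }
  destruct (rect_int_minus _ _ _ _ _ _ EI EA) as [ED HD].
  rewrite rect_int_affine in HD.
  replace (rect_int f x (x + Xn) y (y + Yn) - 0)%C
    with (rect_int f x (x + Xn) y (y + Yn)) in HD by ring.
  rewrite <- HD in B5.
  assert (HB := rect_int_bound _ x (x + Xn) y (y + Yn) (e / (K + 1) * (Xn + Yn))
    ltac:(lra) ltac:(lra) ED).
  assert (HB' : Cmod (rect_int (fun w => f w - (f (u, v) + (w - (u, v)) * l))%C
     x (x + Xn) y (y + Yn)) <= 2 * (x + Xn - x + (y + Yn - y)) * (e / (K + 1) * (Xn + Yn))).
  { apply HB. intros p q Hp Hq _.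
    assert (Hc : Cmod ((p, q) - (u, v)) <= Xn + Yn).
    { replace ((p, q) - (u, v))%C with (p - u, q - v)
        by (apply injective_projections; reflexivity).
      eapply Rle_trans; [apply Cmod_pair_le|].
      apply Rplus_le_compat; apply Rabs_le; lra. }
    replace (f (p, q) - (f (u, v) + ((p, q) - (u, v)) * l))%C
      with (f (p, q) - f (u, v) - ((p, q) - (u, v)) * l)%C by ring.
    eapply Rle_trans. { apply Hw. lra. }
    apply Rmult_le_compat_l; [|easy].
    apply Rlt_le, Rdiv_lt_0_compat; lra. }
  clear HB.
  assert (Hfin : 2 * (x + Xn - x + (y + Yn - y)) * (e / (K + 1) * (Xn + Yn)) = K / (K + 1) * (e / 4 ^ n)).
  { rewrite <- ES. unfold Xn, Yn.
    replace (x + X / 2 ^ n - x + (y + Y / 2 ^ n - y)) with ((X + Y) / 2 ^ n) by (unfold Rdiv; ring).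
    replace (4 ^ n) with (2 ^ n * 2 ^ n) by (rewrite <- Rpow_mult_distr; f_equal; ring).
    unfold K at 2. pose proof (Hp2 n). field. lra. }
  rewrite Hfin in HB'.
  assert (H4 : 0 < e / 4 ^ n) by (apply Rdiv_lt_0_compat; [easy|apply pow_lt; lra]).
  assert (HK1 : K / (K + 1) <= 1).
  { apply Rmult_le_reg_r with (K + 1); [lra|]. unfold Rdiv.
    rewrite Rmult_assoc, Rinv_l; lra. }
  nra.
Qed.

(** * The winding integral and Cauchy's estimate at an inner point *)

Lemma RInt_C_fst_ge (g : R -> C) (k a b m : R) : a <= b ->
  ex_RInt (V := C_R_CompleteNormedModule) g a b ->
  (forall t, a <= t <= b -> m <= k * fst (g t)) ->
  (b - a) * m <= k * fst (RInt (V := C_R_CompleteNormedModule) g a b).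
Proof.
  intros Hab H Hm. apply RInt_correct in H.
  apply (is_RInt_fct_extend_fst (U := R_NormedModule) (V := R_NormedModule)) in H.
  apply (is_RInt_scal _ _ _ k) in H.
  apply (is_RInt_le (fun _ => m) (fun t => k * fst (g t)) a b _ _ Hab); auto.
  - apply (is_RInt_const (V := R_NormedModule)).
  - intros t Ht. apply Hm. lra.
Qed.

Lemma RInt_C_snd_ge (g : R -> C) (k a b m : R) : a <= b ->
  ex_RInt (V := C_R_CompleteNormedModule) g a b ->
  (forall t, a <= t <= b -> m <= k * snd (g t)) ->
  (b - a) * m <= k * snd (RInt (V := C_R_CompleteNormedModule) g a b).
Proof.
  intros Hab H Hm. apply RInt_correct in H.
  apply (is_RInt_fct_extend_snd (U := R_NormedModule) (V := R_NormedModule)) in H.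
  apply (is_RInt_scal _ _ _ k) in H.
  apply (is_RInt_le (fun _ => m) (fun t => k * snd (g t)) a b _ _ Hab); auto.
  - apply (is_RInt_const (V := R_NormedModule)).
  - intros t Ht. apply Hm. lra.
Qed.

Lemma Cdiff_cauchy_kernel (z w : C) : w <> z -> Cdiff (fun u => / (u - z))%C w.
Proof.
  intros H. apply (Cdiff_comp Cinv (fun u => u - z)%C).
  - apply Cdiff_inv. now apply Cminus_eq_contra.
  - apply Cdiff_minus; [apply Cdiff_id|apply Cdiff_const].
Qed.

Lemma boundary_neq (a b c d x0 y0 x y : R) : a < x0 < b -> c < y0 < d ->
  (x = a \/ x = b) \/ (y = c \/ y = d) -> (x, y) <> (x0, y0).
Proof. intros Hx Hy H E. injection E as -> ->. lra. Qed.

(** All four edges contribute positively to the imaginary part: on each, the relevant coordinate of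
    the integrand is the distance of the point from the line of that edge, divided by a squared
    distance that is at most [D]. *)
Lemma winding_neq_0 (a b c d x0 y0 : R) : a < x0 < b -> c < y0 < d ->
  rect_int (fun w => / (w - (x0, y0)))%C a b c d <> 0%C.
Proof.
  intros Hx Hy E.
  assert (Hint : edges_integrable (fun w => / (w - (x0, y0)))%C a b c d).
  { apply edges_integrable_Cdiff; try lra. intros x y _ _ H.
    apply Cdiff_cauchy_kernel. now apply (boundary_neq a b c d). }
  destruct Hint as [[H1 H2] [H3 H4]].
  set (D := (b - a) ^ 2 + (d - c) ^ 2).
  assert (Hq : forall p q r, 0 < p -> 0 < q <= r -> p / r <= p / q).
  { intros p q r Hp Hqr. apply Rmult_le_compat_l; [lra|]. apply Rinv_le_contravar; lra. }
  assert (HD : forall x y, a <= x <= b -> c <= y <= d -> (x, y) <> (x0, y0) ->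
    0 < (x - x0) ^ 2 + (y - y0) ^ 2 <= D).
  { intros x y Hx' Hy' Hne. split.
    - destruct (Req_dec x x0) as [-> | Nx].
      + assert (y - y0 <> 0) by (intros K; apply Hne; f_equal; lra).
        pose proof (pow2_gt_0 _ H). pose proof (pow2_ge_0 (x0 - x0)). lra.
      + assert (x - x0 <> 0) by lra.
        pose proof (pow2_gt_0 _ H). pose proof (pow2_ge_0 (y - y0)). lra.
    - unfold D. apply Rplus_le_compat; apply pow_maj_Rabs; apply Rabs_le; lra. }
  (* The factors [1] and [-1] are the signs with which the edges enter the imaginary part. *)
  assert (K1 := RInt_C_snd_ge _ 1 a b ((y0 - c) / D) ltac:(lra) H1).
  assert (K2 := RInt_C_snd_ge _ (-1) a b ((d - y0) / D) ltac:(lra) H2).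
  assert (K3 := RInt_C_fst_ge _ 1 c d ((b - x0) / D) ltac:(lra) H3).
  assert (K4 := RInt_C_fst_ge _ (-1) c d ((x0 - a) / D) ltac:(lra) H4).
  apply (f_equal snd) in E. unfold rect_int in E.
  assert (Hsum : forall u v p q : C, snd (u - v + Ci * (p - q))%C
    = 1 * snd u + -1 * snd v + (1 * fst p + -1 * fst q)).
  { intros. cbn. ring. }
  rewrite Hsum in E. clear Hsum. cbn [snd RtoC] in E.
  assert (HD0 : 0 < D) by (unfold D; nra).
  assert (P1 : 0 < (b - a) * ((y0 - c) / D)).
  { apply Rmult_lt_0_compat; [lra|]. apply Rdiv_lt_0_compat; lra. }
  assert (P2 : 0 < (b - a) * ((d - y0) / D)).
  { apply Rmult_lt_0_compat; [lra|]. apply Rdiv_lt_0_compat; lra. }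
  assert (P3 : 0 < (d - c) * ((b - x0) / D)).
  { apply Rmult_lt_0_compat; [lra|]. apply Rdiv_lt_0_compat; lra. }
  assert (P4 : 0 < (d - c) * ((x0 - a) / D)).
  { apply Rmult_lt_0_compat; [lra|]. apply Rdiv_lt_0_compat; lra. }
  cut (0 < 0); [lra|].
  rewrite <- E at 2.
  assert (Hn : forall x y, (x = a \/ x = b) \/ (y = c \/ y = d) -> (x, y) <> (x0, y0)).
  { intros x y. now apply boundary_neq. }
  apply Rplus_lt_0_compat; apply Rplus_lt_0_compat.
  - eapply Rlt_le_trans; [exact P1|apply K1]. intros t Ht.
    replace (1 * snd (/ ((t, c) - (x0, y0)))%C)
      with ((y0 - c) / ((t - x0) ^ 2 + (c - y0) ^ 2)) by (cbn; unfold Rdiv, Rminus; ring).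
    apply Hq; [lra|]. apply HD; auto; lra.
  - eapply Rlt_le_trans; [exact P2|apply K2]. intros t Ht.
    replace (-1 * snd (/ ((t, d) - (x0, y0)))%C)
      with ((d - y0) / ((t - x0) ^ 2 + (d - y0) ^ 2)) by (cbn; unfold Rdiv, Rminus; ring).
    apply Hq; [lra|]. apply HD; auto; lra.
  - eapply Rlt_le_trans; [exact P3|apply K3]. intros t Ht.
    replace (1 * fst (/ ((b, t) - (x0, y0)))%C)
      with ((b - x0) / ((b - x0) ^ 2 + (t - y0) ^ 2)) by (cbn; unfold Rdiv, Rminus; ring).
    apply Hq; [lra|]. apply HD; auto; lra.
  - eapply Rlt_le_trans; [exact P4|apply K4]. intros t Ht.
    replace (-1 * fst (/ ((a, t) - (x0, y0)))%C)
      with ((x0 - a) / ((a - x0) ^ 2 + (t - y0) ^ 2)) by (cbn; unfold Rdiv, Rminus; ring).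
    apply Hq; [lra|]. apply HD; auto; lra.
Qed.

(** By Goursat the integral equals the one over an arbitrarily small square around the point. Since
    [G] stays bounded there, that integral is at most a constant times the side of the square. *)
Lemma rect_int_removable (G : C -> C) (a b c d x0 y0 B e : R) :
  a < x0 < b -> c < y0 < d -> 0 < e ->
  (forall x y, a <= x <= b -> c <= y <= d -> (x, y) <> (x0, y0) -> Cdiff G (x, y)) ->
  (forall w, w <> (x0, y0) -> Cmod (w - (x0, y0)) < e -> Cmod (G w) <= B) ->
  rect_int G a b c d = 0%C.
Proof.
  intros Hx Hy He HG HGB. apply Cmod_eq_0.
  apply Rle_antisym; [|apply Cmod_ge_0]. apply Rnot_lt_le. intros Hpos.
  set (I := Cmod (rect_int G a b c d)) in *.
  assert (B0 : 0 < Rabs B + 1) by (pose proof (Rabs_pos B); lra).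
  (* The square has side [m]. The bounds keep it inside the disc of radius [e] and inside the
     rectangle, and make the integral over it at most [I / 4]. *)
  set (m := Rmin (Rmin (e / 4) (I / (16 * (Rabs B + 1))))
              (Rmin (Rmin (x0 - a) (b - x0)) (Rmin (y0 - c) (d - y0)))).
  assert (Hm : 0 < m).
  { unfold m. repeat apply Rmin_pos; try lra. apply Rdiv_lt_0_compat; lra. }
  assert (M1 : m <= e / 4).
  { unfold m. eapply Rle_trans; [apply Rmin_l|apply Rmin_l]. }
  assert (M2 : m <= I / (16 * (Rabs B + 1))).
  { unfold m. eapply Rle_trans; [apply Rmin_l|apply Rmin_r]. }
  assert (M3 : m <= x0 - a).
  { unfold m. eapply Rle_trans; [apply Rmin_r|]. eapply Rle_trans; [apply Rmin_l|apply Rmin_l]. }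
  assert (M4 : m <= b - x0).
  { unfold m. eapply Rle_trans; [apply Rmin_r|]. eapply Rle_trans; [apply Rmin_l|apply Rmin_r]. }
  assert (M5 : m <= y0 - c).
  { unfold m. eapply Rle_trans; [apply Rmin_r|]. eapply Rle_trans; [apply Rmin_r|apply Rmin_l]. }
  assert (M6 : m <= d - y0).
  { unfold m. eapply Rle_trans; [apply Rmin_r|]. eapply Rle_trans; [apply Rmin_r|apply Rmin_r]. }
  clearbody m. assert (HR : exists r, m = 2 * r) by (exists (m / 2); field).
  destruct HR as [r ->]. assert (Hr : 0 < r) by lra.
  assert (E : forall p q u v, a <= p <= q -> q <= b -> c <= u <= v -> v <= d ->
    (p <> x0 /\ q <> x0) -> (u <> y0 /\ v <> y0) -> edges_integrable G p q u v).
  { intros p q u v H1 H2 H3 H4 H5 H6. apply edges_integrable_Cdiff; try lra.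
    intros x y Hx' Hy' H. apply HG; try lra. intros K; injection K; intros. lra. }
  assert (Z : forall p q u v, a <= p <= q -> q <= b -> c <= u <= v -> v <= d ->
    (q < x0 \/ x0 < p) \/ (v < y0 \/ y0 < u) -> rect_int G p q u v = 0%C).
  { intros p q u v H1 H2 H3 H4 H5. apply goursat_rect; try lra.
    intros x y Hx' Hy'. apply HG; try lra. intros K; injection K; intros. lra. }
  assert (HI : rect_int G a b c d = rect_int G (x0 - r) (x0 + r) (y0 - r) (y0 + r)).
  { rewrite (rect_int_split_x G a (x0 - r) b) by (apply E; lra).
    rewrite (rect_int_split_x G (x0 - r) (x0 + r) b) by (apply E; lra).
    rewrite (rect_int_split_y G (x0 - r) (x0 + r) c (y0 - r) d) by (apply E; lra).
    rewrite (rect_int_split_y G (x0 - r) (x0 + r) (y0 - r) (y0 + r) d) by (apply E; lra).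
    rewrite (Z a (x0 - r) c d), (Z (x0 + r) b c d), (Z (x0 - r) (x0 + r) c (y0 - r)),
      (Z (x0 - r) (x0 + r) (y0 + r) d) by lra.
    ring. }
  assert (HB : I <= 2 * (x0 + r - (x0 - r) + (y0 + r - (y0 - r))) * (Rabs B + 1)).
  { unfold I. rewrite HI. apply rect_int_bound; try lra.
    - apply E; lra.
    - intros x y Hx' Hy' H. pose proof (Rle_abs B).
      apply Rle_trans with B; [|lra]. apply HGB.
      + intros K; injection K; intros. lra.
      + replace ((x, y) - (x0, y0))%C with (x - x0, y - y0)
          by (apply injective_projections; reflexivity).
        eapply Rle_lt_trans; [apply Cmod_pair_le|].
        apply Rle_lt_trans with (r + r); [|lra].
        apply Rplus_le_compat; apply Rabs_le; lra. }
  apply Rmult_le_compat_r with (r := 16 * (Rabs B + 1)) in M2; [|lra].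
  replace (I / (16 * (Rabs B + 1)) * (16 * (Rabs B + 1))) with I in M2 by (field; lra).
  nra.
Qed.

(** Normalizing [H] to the value 1 at the centre, only the nonvanishing of the
    winding integral is needed, not its value [2 i PI]. *)
Lemma rect_cauchy_bound (a b c d x0 y0 : R) : a < x0 < b -> c < y0 < d ->
  exists C0 : R, 0 < C0 /\ forall (H : C -> C) (B : R),
    Cdiff_rect H a b c d ->
    (forall x y, a <= x <= b -> c <= y <= d ->
       (x = a \/ x = b) \/ (y = c \/ y = d) -> Cmod (H (x, y)) <= B) ->
    Cmod (H (x0, y0)) <= C0 * B.
Proof.
  intros Hx Hy.
  set (w0 := (x0, y0) : C).
  set (om := rect_int (fun w => / (w - w0))%C a b c d).
  assert (Hom : 0 < Cmod om).
  { apply Cmod_gt_0. now apply winding_neq_0. }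
  set (m := Rmin (Rmin (x0 - a) (b - x0)) (Rmin (y0 - c) (d - y0))).
  assert (Hm : 0 < m) by (unfold m; repeat apply Rmin_pos; lra).
  assert (M3 : m <= x0 - a).
  { unfold m. eapply Rle_trans; [apply Rmin_l|apply Rmin_l]. }
  assert (M4 : m <= b - x0).
  { unfold m. eapply Rle_trans; [apply Rmin_l|apply Rmin_r]. }
  assert (M5 : m <= y0 - c).
  { unfold m. eapply Rle_trans; [apply Rmin_r|apply Rmin_l]. }
  assert (M6 : m <= d - y0).
  { unfold m. eapply Rle_trans; [apply Rmin_r|apply Rmin_r]. }
  assert (Hdist : forall x y, (x = a \/ x = b) \/ (y = c \/ y = d) -> m <= Cmod ((x, y) - w0)).
  { intros x y Hb. eapply Rle_trans; [|apply Rmax_Cmod]. cbn [fst snd Cminus Cplus Copp w0].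
    destruct Hb as [Hb|Hb].
    - eapply Rle_trans; [|apply Rmax_l]. unfold Rabs. destruct Rcase_abs; cbn in *; lra.
    - eapply Rle_trans; [|apply Rmax_r]. unfold Rabs. destruct Rcase_abs; cbn in *; lra. }
  (* This is the perimeter over [m * Cmod om]: the normalized integrand [G1] is at most
     [B / (Cmod (H w0) * m)] on the boundary, and its integral is [om]. *)
  exists (2 * ((b - a) + (d - c)) / (m * Cmod om)). split.
  { apply Rdiv_lt_0_compat; [lra|]. now apply Rmult_lt_0_compat. }
  intros H B HH HB.
  assert (HB0 : 0 <= B).
  { eapply Rle_trans; [apply Cmod_ge_0|]. apply (HB a c); auto; lra. }
  destruct (Req_dec (Cmod (H w0)) 0) as [E0|N0].
  { rewrite E0. apply Rmult_le_pos; [|easy]. apply Rlt_le, Rdiv_lt_0_compat; [lra|].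
    now apply Rmult_lt_0_compat. }
  assert (P0 : 0 < Cmod (H w0)) by (pose proof (Cmod_ge_0 (H w0)); lra).
  assert (N1 : H w0 <> 0%C) by now apply Cmod_gt_0.
  set (G1 := (fun w => H w * / H w0 * / (w - w0))%C).
  set (G2 := (fun w => / (w - w0))%C).
  assert (HG2 : forall w, w <> w0 -> Cdiff G2 w).
  { intros w Hw. now apply Cdiff_cauchy_kernel. }
  assert (HG1 : forall x y, a <= x <= b -> c <= y <= d -> (x, y) <> w0 -> Cdiff G1 (x, y)).
  { intros x y Hx' Hy' Hn. apply Cdiff_mult; [|now apply HG2].
    apply Cdiff_mult; [|apply Cdiff_const]. now apply HH. }
  assert (Hn : forall x y, (x = a \/ x = b) \/ (y = c \/ y = d) -> (x, y) <> w0).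
  { intros x y. now apply boundary_neq. }
  assert (E1 : edges_integrable G1 a b c d).
  { apply edges_integrable_Cdiff; try lra. intros; apply HG1; auto. }
  assert (E2 : edges_integrable G2 a b c d).
  { apply edges_integrable_Cdiff; try lra. intros; apply HG2; auto. }
  assert (HI : rect_int G1 a b c d = om).
  { destruct (rect_int_minus G1 G2 a b c d E1 E2) as [_ HM].
    (* [G1 - G2] is the difference quotient of [H] at [w0] divided by [H w0]; differentiability
       bounds it near [w0], so the singularity is removable. *)
    assert (HZ : rect_int (fun w => G1 w - G2 w)%C a b c d = 0%C).
    { assert (Hd := HH x0 y0 ltac:(lra) ltac:(lra)). fold w0 in Hd.
      apply Cdiff_eps in Hd. destruct Hd as [l Hl].
      destruct (Hl 1 Rlt_0_1) as [e [He Hw]].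
      apply (rect_int_removable _ a b c d x0 y0 ((1 + Cmod l) / Cmod (H w0)) e); auto.
      - intros x y Hx' Hy' Hxy. apply Cdiff_minus; auto.
      - intros w Hw1 Hw2. specialize (Hw w Hw2). fold w0 in Hw1, Hw2.
        assert (Q : 0 < Cmod (w - w0)) by (apply Cmod_gt_0; now apply Cminus_eq_contra).
        replace (G1 w - G2 w)%C with ((H w - H w0 - (w - w0) * l + (w - w0) * l) * / (H w0 * (w - w0)))%C
          by (unfold G1, G2; field; split; auto; now apply Cminus_eq_contra).
        rewrite Cmod_mult, Cmod_inv, Cmod_mult
          by (apply Cmult_neq_0; auto; now apply Cminus_eq_contra).
        assert (T := Cmod_triangle (H w - H w0 - (w - w0) * l) ((w - w0) * l)).
        rewrite (Cmod_mult (w - w0) l) in T.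
        apply Rle_trans with ((1 + Cmod l) * Cmod (w - w0) * / (Cmod (H w0) * Cmod (w - w0))).
        { apply Rmult_le_compat_r; [|lra].
          apply Rlt_le, Rinv_0_lt_compat. now apply Rmult_lt_0_compat. }
        right. field. lra. }
    rewrite HZ in HM. fold G2 in om. fold om in HM.
    replace om with (om + 0)%C by ring. rewrite HM. ring. }
  assert (HF := rect_int_bound G1 a b c d (B / (Cmod (H w0) * m)) ltac:(lra) ltac:(lra) E1).
  rewrite HI in HF.
  assert (HF' : Cmod om <= 2 * (b - a + (d - c)) * (B / (Cmod (H w0) * m))).
  { apply HF. intros x y Hx' Hy' Hb. unfold G1.
    rewrite !Cmod_mult, !Cmod_inv by (auto; apply Cminus_eq_contra; auto).
    specialize (HB x y Hx' Hy' Hb). specialize (Hdist x y Hb).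
    unfold Rdiv. rewrite Rinv_mult, <- Rmult_assoc.
    pose proof (Cmod_ge_0 (H (x, y))).
    assert (0 < / Cmod (H w0)) by now apply Rinv_0_lt_compat.
    apply Rmult_le_compat.
    - apply Rmult_le_pos; lra.
    - apply Rlt_le, Rinv_0_lt_compat. lra.
    - apply Rmult_le_compat_r; lra.
    - apply Rinv_le_contravar; lra. }
  apply Rmult_le_reg_r with (m * Cmod om / Cmod (H w0)).
  { apply Rdiv_lt_0_compat; auto. now apply Rmult_lt_0_compat. }
  apply Rle_trans with (m * Cmod om). { right. field. lra. }
  apply Rle_trans with (m * (2 * (b - a + (d - c)) * (B / (Cmod (H w0) * m)))).
  { apply Rmult_le_compat_l; lra. }
  right. field. lra.
Qed.

(** * The two-constants theorem *)

Lemma proj_plus (u v : C) : proj (u + v)%C = (proj u * proj v)%C.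
Proof.
  destruct u as [u1 u2], v as [v1 v2]. unfold proj, rmod, rarg; cbn.
  rewrite exp_plus, cos_plus, sin_plus.
  apply injective_projections; cbn; ring.
Qed.

Lemma Cmod_proj (w : C) : Cmod (proj w) = rmod w.
Proof.
  unfold proj, Cmod; cbn [fst snd].
  replace ((rmod w * cos (rarg w)) ^ 2 + (rmod w * sin (rarg w)) ^ 2)
    with (rmod w ^ 2 * (Rsqr (sin (rarg w)) + Rsqr (cos (rarg w))))
    by (unfold Rsqr; ring).
  rewrite sin2_cos2, Rmult_1_r, <- Rsqr_pow2. apply sqrt_Rsqr.
  apply Rlt_le, exp_pos.
Qed.

Lemma derivable_pt_lim_linear (f : R -> R) (x l eps : R) :
  derivable_pt_lim f x l -> 0 < eps ->
  exists d, 0 < d /\ forall h, Rabs h < d -> Rabs (f (x + h) - f x - l * h) <= eps * Rabs h.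
Proof.
  intros H Heps. destruct (H eps Heps) as [d Hd]. exists d. split; [apply cond_pos|].
  intros h Hh. destruct (Req_dec h 0) as [->|N].
  { rewrite Rplus_0_r. replace (f x - f x - l * 0) with 0 by ring.
    rewrite Rabs_R0. lra. }
  specialize (Hd h N Hh).
  replace (f (x + h) - f x - l * h) with (((f (x + h) - f x) / h - l) * h) by (now field).
  rewrite Rabs_mult. apply Rmult_le_compat_r; [apply Rabs_pos|lra].
Qed.

Lemma proj_diff_0 (eps : R) : 0 < eps -> exists d, 0 < d /\
  forall v : C, Cmod v < d -> Cmod (proj v - 1 - v) <= eps * Cmod v.
Proof.
  (* The four error terms below add up to at most [9 * e * t]; the bound [e <= 1] serves to estimate
     [p + 1 + x], which is [exp x], by [3]. *)
  intros Heps. set (e := Rmin (eps / 16) 1).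
  assert (He : 0 < e) by (apply Rmin_pos; lra).
  assert (He1 : e <= eps / 16) by apply Rmin_l.
  assert (He2 : e <= 1) by apply Rmin_r.
  destruct (derivable_pt_lim_linear exp 0 _ e (derivable_pt_lim_exp 0) He) as [d1 [D1 H1]].
  destruct (derivable_pt_lim_linear cos 0 _ e (derivable_pt_lim_cos 0) He) as [d2 [D2 H2]].
  destruct (derivable_pt_lim_linear sin 0 _ e (derivable_pt_lim_sin 0) He) as [d3 [D3 H3]].
  exists (Rmin e (Rmin d1 (Rmin d2 d3))). split. { repeat apply Rmin_pos; lra. }
  intros [x y] Hv.
  assert (V0 := Rlt_le_trans _ _ _ Hv (Rmin_l _ _)).
  assert (V := Rlt_le_trans _ _ _ Hv (Rmin_r _ _)).
  assert (V1 := Rlt_le_trans _ _ _ V (Rmin_l _ _)).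
  assert (V' := Rlt_le_trans _ _ _ V (Rmin_r _ _)).
  assert (V2 := Rlt_le_trans _ _ _ V' (Rmin_l _ _)).
  assert (V3 := Rlt_le_trans _ _ _ V' (Rmin_r _ _)).
  clear V V' Hv.
  assert (Hx : Rabs x <= Cmod (x, y)) by (eapply Rle_trans; [apply Rmax_l|apply (Rmax_Cmod (x, y))]).
  assert (Hy : Rabs y <= Cmod (x, y)) by (eapply Rle_trans; [apply Rmax_r|apply (Rmax_Cmod (x, y))]).
  set (t := Cmod (x, y)) in *. clearbody t.
  assert (A1 := H1 x ltac:(lra)). assert (A2 := H2 y ltac:(lra)). assert (A3 := H3 y ltac:(lra)).
  rewrite Rplus_0_l in A1, A2, A3.
  rewrite exp_0 in A1. rewrite cos_0, sin_0 in A2. rewrite sin_0, cos_0 in A3.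
  pose proof (Rabs_pos x). pose proof (Rabs_pos y).
  set (p := exp x - 1 - 1 * x) in *. set (q := cos y - 1 - - 0 * y) in *.
  set (s := sin y - 0 - 1 * y) in *.
  replace (proj (x, y) - 1 - (x, y))%C
    with (p + (p + 1 + x) * q, (p + 1 + x) * s + (p + x) * y)
    by (unfold p, q, s, proj, rmod, rarg; apply injective_projections; cbn; ring).
  eapply Rle_trans; [apply Cmod_pair_le|].
  assert (P : Rabs p <= e * t) by nra.
  assert (Q : Rabs q <= e * t) by nra.
  assert (S : Rabs s <= e * t) by nra.
  assert (P1 : Rabs (p + 1 + x) <= 3).
  { eapply Rle_trans; [apply Rabs_triang|]. eapply Rle_trans.
    { apply Rplus_le_compat_r, Rabs_triang. } rewrite Rabs_R1. nra. }
  assert (P2 : Rabs (p + x) <= 2 * e).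
  { eapply Rle_trans; [apply Rabs_triang|]. nra. }
  pose proof (Rabs_triang p ((p + 1 + x) * q)) as T1.
  pose proof (Rabs_triang ((p + 1 + x) * s) ((p + x) * y)) as T2.
  rewrite Rabs_mult in T1. rewrite !Rabs_mult in T2.
  assert (M1 : Rabs (p + 1 + x) * Rabs q <= 3 * (e * t)).
  { apply Rmult_le_compat; auto using Rabs_pos. }
  assert (M2 : Rabs (p + 1 + x) * Rabs s <= 3 * (e * t)).
  { apply Rmult_le_compat; auto using Rabs_pos. }
  assert (M3 : Rabs (p + x) * Rabs y <= 2 * e * t).
  { apply Rmult_le_compat; auto using Rabs_pos. }
  nra.
Qed.

Lemma Cdiff_proj (z : C) : Cdiff proj z.
Proof.
  apply Cdiff_eps. exists (proj z). intros eps Heps.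
  assert (Hz : 0 < Cmod (proj z)) by (rewrite Cmod_proj; apply exp_pos).
  destruct (proj_diff_0 (eps / Cmod (proj z))) as [d [Hd H]].
  { now apply Rdiv_lt_0_compat. }
  exists d. split; [easy|]. intros w Hw. specialize (H _ Hw).
  replace (proj w) with (proj z * proj (w - z))%C
    by (rewrite <- proj_plus; f_equal; ring).
  replace (proj z * proj (w - z) - proj z - (w - z) * proj z)%C
    with (proj z * (proj (w - z) - 1 - (w - z)))%C by ring.
  rewrite Cmod_mult.
  apply Rle_trans with (Cmod (proj z) * (eps / Cmod (proj z) * Cmod (w - z))).
  { apply Rmult_le_compat_l; lra. }
  right. field. lra.
Qed.

Lemma exp_le_mono (x y : R) : x <= y -> exp x <= exp y.
Proof.
  intros [H | ->]; [apply Rlt_le; now apply exp_increasing|apply Rle_refl].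
Qed.

(** The weight [exp (L exp (- k w))], with [k h = PI / 2], has modulus [1] on the
    horizontal sides and modulus decreasing along the real axis. *)
Lemma two_constants (a x0 b h : R) : a < x0 < b -> 0 < h ->
  exists C0 Ea E0 Eb : R, 0 < C0 /\ Eb < E0 /\
  forall (F : C -> C) (eps B L : R), 0 <= L ->
    Cdiff_rect F a b (- h) h ->
    (forall y, - h <= y <= h -> Cmod (F (a, y)) <= eps) ->
    (forall x y, a <= x <= b -> - h <= y <= h -> Cmod (F (x, y)) <= B) ->
    Cmod (F (x0, 0)) * exp (L * E0) <= C0 * (eps * exp (L * Ea) + B * exp (L * Eb)).
Proof.
  intros Hx Hh.
  destruct (rect_cauchy_bound a b (- h) h x0 0) as [C0 [HC0 HC]]; try lra.
  set (k := PI / (2 * h)).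
  assert (Hk : 0 < k) by (apply Rdiv_lt_0_compat; [apply PI_RGT_0|lra]).
  exists C0, (exp (- k * a)), (exp (- k * x0)), (exp (- k * b)).
  split; [easy|]. split. { apply exp_increasing. nra. }
  intros F eps B L HL HF Heps HB.
  set (W := fun w : C => proj (RtoC L * proj (RtoC (- k) * w))%C).
  assert (HW : forall w, Cdiff W w).
  { intros w. apply (Cdiff_comp proj (fun w => RtoC L * proj (RtoC (- k) * w))%C).
    { apply Cdiff_proj. }
    apply Cdiff_mult; [apply Cdiff_const|].
    apply (Cdiff_comp proj (fun w => RtoC (- k) * w)%C). { apply Cdiff_proj. }
    apply Cdiff_mult; [apply Cdiff_const|apply Cdiff_id]. }
  assert (MW : forall x y, Cmod (W (x, y)) = exp (L * (exp (- k * x) * cos (k * y)))).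
  { intros x y. unfold W. rewrite Cmod_proj. unfold rmod, proj, rarg; cbn.
    replace (- k * x - 0 * y) with (- k * x) by ring.
    replace (- k * y + 0 * x) with (- (k * y)) by ring.
    rewrite cos_neg.
    replace (rmod (RtoC (- k) * (x, y))%C) with (exp (- k * x))
      by (unfold rmod; f_equal; cbn; ring).
    f_equal. ring. }
  assert (B0 : 0 <= B).
  { eapply Rle_trans; [apply Cmod_ge_0|]. apply (HB a 0); lra. }
  assert (eps0 : 0 <= eps).
  { eapply Rle_trans; [apply Cmod_ge_0|]. apply (Heps 0); lra. }
  assert (Hcos : cos (k * h) = 0 /\ cos (k * - h) = 0).
  { replace (k * - h) with (- (k * h)) by ring. rewrite cos_neg.
    replace (k * h) with (PI / 2) by (unfold k; field; lra).
    rewrite cos_PI2. auto. }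
  destruct Hcos as [Hc1 Hc2].
  assert (Hexp : forall x y, exp (L * (exp (- k * x) * cos (k * y))) <= exp (L * exp (- k * x))).
  { intros x y. apply exp_le_mono. apply Rmult_le_compat_l; [easy|].
    pose proof (exp_pos (- k * x)). pose proof (COS_bound (k * y)). nra. }
  replace (Cmod (F (x0, 0)) * exp (L * exp (- k * x0)))
    with (Cmod (F (x0, 0) * W (x0, 0))%C)
    by (rewrite Cmod_mult, MW, Rmult_0_r, cos_0, Rmult_1_r; reflexivity).
  apply (HC (fun w => F w * W w)%C).
  - intros x y Hx' Hy'. apply Cdiff_mult; auto.
  - intros x y Hx' Hy' Hb. rewrite Cmod_mult, MW.
    assert (Q1 : 0 <= eps * exp (L * exp (- k * a))).
    { apply Rmult_le_pos; [easy|apply Rlt_le, exp_pos]. }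
    assert (Q2 : 0 <= B * exp (L * exp (- k * b))).
    { apply Rmult_le_pos; [easy|apply Rlt_le, exp_pos]. }
    (* The horizontal sides, where the weight has modulus [1], are absorbed by the term of the side
       at [b]. *)
    assert (Q3 : 1 <= exp (L * exp (- k * b))).
    { rewrite <- exp_0. apply exp_le_mono. apply Rmult_le_pos; [easy|apply Rlt_le, exp_pos]. }
    specialize (HB x y Hx' Hy').
    destruct Hb as [[-> | ->] | Hb].
    + eapply Rle_trans.
      { apply Rmult_le_compat; [apply Cmod_ge_0|apply Rlt_le, exp_pos|now apply Heps|apply Hexp]. }
      lra.
    + eapply Rle_trans.
      { apply Rmult_le_compat; [apply Cmod_ge_0|apply Rlt_le, exp_pos|exact HB|apply Hexp]. }
      lra.
    + assert (Hz : cos (k * y) = 0) by (destruct Hb as [-> | ->]; assumption).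
      rewrite Hz, !Rmult_0_r, exp_0. nra.
Qed.

(** * Growth of the quotients *)

Lemma quotients_pos (M : nat -> R) (p : nat) : weight_sequence M -> 0 < quotients M p.
Proof. intros [H _]. unfold quotients. now apply Rdiv_lt_0_compat. Qed.

Lemma quotients_mono (M : nat -> R) (p q : nat) : weight_sequence M -> (p <= q)%nat ->
  quotients M p <= quotients M q.
Proof.
  intros (H0 & _ & Hc & _) Hpq. induction Hpq as [|q Hpq IH]; [lra|].
  eapply Rle_trans; [exact IH|]. unfold quotients.
  specialize (Hc (S q) ltac:(lia)).
  replace (S q - 1)%nat with q in Hc by lia. replace (S q + 1)%nat with (S (S q)) in Hc by lia.
  pose proof (H0 q). pose proof (H0 (S q)).
  apply Rmult_le_reg_r with (M q * M (S q)). { now apply Rmult_lt_0_compat. }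
  replace (M (S q) / M q * (M q * M (S q))) with (M (S q) ^ 2) by (field; lra).
  replace (M (S (S q)) / M (S q) * (M q * M (S q))) with (M q * M (S (S q))) by (field; lra).
  easy.
Qed.

Definition quotient_growth (M : nat -> R) : Prop :=
  exists N P : nat, (2 <= N)%nat /\ (1 <= P)%nat /\
  forall p, (P <= p)%nat -> 2 * quotients M p <= quotients M (N * p).

(** * Strong nonquasianalyticity and growth of the quotients *)

Fixpoint block_sum (u : nat -> R) (p n : nat) : R :=
  match n with
  | O => 0
  | S k => block_sum u p k + u (p + k)%nat
  end.

Lemma block_sum_add (u : nat -> R) (p n k : nat) :
  block_sum u p (n + k) = block_sum u p n + block_sum u (p + n) k.
Proof.
  induction k as [|k IH].
  - rewrite Nat.add_0_r. cbn. ring.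
  - rewrite Nat.add_succ_r. cbn. rewrite IH, Nat.add_assoc. ring.
Qed.

Lemma sum_n_block_sum (u : nat -> R) (p n : nat) :
  sum_n (fun k => u (p + k)%nat) n = block_sum u p (S n).
Proof.
  induction n as [|n IH].
  - rewrite sum_O. cbn. ring.
  - rewrite sum_Sn, IH. reflexivity.
Qed.

Lemma block_sum_le (u : nat -> R) (p n : nat) (c : R) :
  (forall k, (k < n)%nat -> u (p + k)%nat <= c) -> block_sum u p n <= INR n * c.
Proof.
  induction n as [|n IH]; intros H.
  - cbn. lra.
  - cbn [block_sum]. rewrite S_INR.
    specialize (IH ltac:(intros; apply H; lia)). specialize (H n ltac:(lia)). lra.
Qed.

Lemma block_sum_ge (u : nat -> R) (p n : nat) (c : R) :
  (forall k, (k < n)%nat -> c <= u (p + k)%nat) -> INR n * c <= block_sum u p n.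
Proof.
  induction n as [|n IH]; intros H.
  - cbn. lra.
  - cbn [block_sum]. rewrite S_INR.
    specialize (IH ltac:(intros; apply H; lia)). specialize (H n ltac:(lia)). lra.
Qed.

(** For nonnegative terms a uniform bound on the partial sums gives convergence and the bound on the
    sum at once, which turns (snq) into a statement on finite blocks. *)
Lemma series_bound_block_sum (u : nat -> R) (p : nat) (c : R) : (forall q, 0 <= u q) ->
  (ex_series (fun k => u (p + k)%nat) /\ Series (fun k => u (p + k)%nat) <= c <->
   forall n, block_sum u p n <= c).
Proof.
  intros Hu.
  assert (Hincr : forall n, sum_n (fun k => u (p + k)%nat) n
    <= sum_n (fun k => u (p + k)%nat) (S n)).
  { intros n. rewrite sum_Sn. unfold plus; cbn. pose proof (Hu (p + S n)%nat). lra. }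
  split.
  - intros [He Hs] [|n].
    + cbn. apply Series_correct in He.
      eapply Rle_trans; [|exact Hs].
      eapply Rle_trans; [|apply (is_lim_seq_incr_compare _ _ He Hincr 0%nat)].
      rewrite sum_n_block_sum. cbn. pose proof (Hu (p + 0)%nat). lra.
    + apply Series_correct in He. rewrite <- sum_n_block_sum.
      eapply Rle_trans; [|exact Hs]. apply (is_lim_seq_incr_compare _ _ He Hincr n).
  - intros H.
    assert (He : ex_series (fun k => u (p + k)%nat)).
    { apply (ex_finite_lim_seq_incr _ c Hincr). intros n. rewrite sum_n_block_sum. apply H. }
    split; [easy|]. apply Series_correct in He.
    apply (is_lim_seq_le (sum_n (fun k => u (p + k)%nat)) (fun _ => c) (Finite (Series (fun k => u (p + k)%nat))) (Finite c)).
    + intros n. rewrite sum_n_block_sum. apply H.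
    + exact He.
    + apply is_lim_seq_const.
Qed.

Definition snq_term (M : nat -> R) (q : nat) : R := / (INR (q + 1) * quotients M q).

Lemma INR_S_pos (q : nat) : 0 < INR (q + 1).
Proof. apply lt_0_INR. lia. Qed.

Lemma snq_term_pos (M : nat -> R) (q : nat) : weight_sequence M -> 0 < snq_term M q.
Proof.
  intros HM. apply Rinv_0_lt_compat, Rmult_lt_0_compat; [apply INR_S_pos|].
  now apply quotients_pos.
Qed.

Lemma snq_block_sum (M : nat -> R) : weight_sequence M ->
  (snq M <-> exists B, 0 < B /\ forall p n, block_sum (snq_term M) p n <= B / quotients M p).
Proof.
  intros HM. pose proof HM as [H0 _].
  assert (Ht : forall p k, M (p + k)%nat / (INR (p + k + 1) * M (p + k + 1)%nat) = snq_term M (p + k)).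
  { intros p k. unfold snq_term, quotients. replace (p + k + 1)%nat with (S (p + k)) by lia.
    pose proof (H0 (p + k)%nat). pose proof (H0 (S (p + k))). pose proof (lt_0_INR (S (p + k)) ltac:(lia)).
    field. repeat split; lra. }
  assert (Hb : forall B p, B * (M p / M (p + 1)%nat) = B / quotients M p).
  { intros B p. unfold quotients. replace (p + 1)%nat with (S p) by lia.
    pose proof (H0 p). pose proof (H0 (S p)). field. lra. }
  assert (Hu : forall q, 0 <= snq_term M q) by (intros; apply Rlt_le; now apply snq_term_pos).
  split; intros [B [HB H]]; exists B; split; auto; intros p.
  - destruct (H p) as [He Hs]. rewrite Hb in Hs.
    apply (series_bound_block_sum _ p _ Hu). split.
    + eapply ex_series_ext; [|exact He]. intros k. apply Ht.
    + erewrite Series_ext; [exact Hs|]. intros k. symmetry. apply Ht.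
  - rewrite Hb. apply (series_bound_block_sum _ p _ Hu) in H. destruct H as [He Hs]. split.
    + eapply ex_series_ext; [|exact He]. intros k. symmetry. apply Ht.
    + erewrite Series_ext; [exact Hs|]. intros k. apply Ht.
Qed.

(** Cut the indices at [p], [N p], [N^2 p] and so on. A block contributes at most [N] over the
    quotient at its start, and these quotients at least double from block to block, so a geometric
    series dominates. *)
Lemma snq_of_growth (M : nat -> R) : weight_sequence M -> quotient_growth M -> snq M.
Proof.
  intros HM (N & P & HN & HP & HG). apply (snq_block_sum M HM).
  pose proof (fun p => quotients_pos M p HM) as Hpos.
  assert (Hm : forall p q, (p <= q)%nat -> / quotients M q <= / quotients M p).
  { intros p q Hpq. apply Rinv_le_contravar; auto. now apply quotients_mono. }
  assert (Hip : forall p, 0 < / quotients M p) by (intros; now apply Rinv_0_lt_compat).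
  assert (N1 : 2 <= INR N) by (apply (le_INR 2); lia).
  (* The constant solves [x = N + x / 2]: the first block costs [N], and the rest, by induction from
     [N p], half of the total. *)
  assert (HA : forall n p, (P <= p)%nat -> block_sum (snq_term M) p n <= 2 * INR N * / quotients M p).
  { induction n as [n IH] using (well_founded_induction Wf_nat.lt_wf). intros p Hp.
    assert (Hp1 : 0 < INR p) by (apply lt_0_INR; lia).
    assert (Hfirst : forall k, (k <= (N - 1) * p)%nat ->
      block_sum (snq_term M) p k <= INR N * / quotients M p).
    { intros k Hk. eapply Rle_trans.
      - apply (block_sum_le _ p k (/ INR p * / quotients M p)). intros i Hi.
        unfold snq_term. rewrite Rinv_mult. apply Rmult_le_compat.
        + apply Rlt_le, Rinv_0_lt_compat, INR_S_pos.
        + apply Rlt_le, Hip.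
        + apply Rinv_le_contravar; auto. apply le_INR. lia.
        + apply Hm. lia.
      - rewrite <- Rmult_assoc. apply Rmult_le_compat_r; [apply Rlt_le, Hip|].
        apply Rmult_le_reg_r with (INR p); auto.
        rewrite Rmult_assoc, Rinv_l, Rmult_1_r, <- mult_INR by lra.
        apply le_INR. nia. }
    pose proof (Hip p).
    destruct (Nat.le_gt_cases n ((N - 1) * p)) as [Hn|Hn].
    - specialize (Hfirst n Hn). nra.
    - replace n with ((N - 1) * p + (n - (N - 1) * p))%nat by lia.
      rewrite block_sum_add. specialize (Hfirst ((N - 1) * p)%nat ltac:(lia)).
      replace (p + (N - 1) * p)%nat with (N * p)%nat by nia.
      assert (K := IH (n - (N - 1) * p)%nat ltac:(nia) (N * p)%nat ltac:(nia)).
      specialize (HG p Hp).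
      assert (L : / quotients M (N * p) <= / quotients M p / 2).
      { replace (/ quotients M p / 2) with (/ (2 * quotients M p))
          by (field; pose proof (Hpos p); lra).
        apply Rinv_le_contravar; auto. pose proof (Hpos p). lra. }
      nra. }
  exists (INR P + 2 * INR N). split. { pose proof (pos_INR P). lra. }
  intros p n. unfold Rdiv. pose proof (Hip p).
  (* For an arbitrary [p] the growth is available from [p + P] on; each of the [P] terms before is
     at most the inverse of the quotient at [p]. *)
  assert (Hfirst : forall k, (k <= P)%nat -> block_sum (snq_term M) p k <= INR P * / quotients M p).
  { intros k Hk. eapply Rle_trans.
    - apply (block_sum_le _ p k (/ quotients M p)). intros i Hi.
      unfold snq_term. rewrite Rinv_mult. rewrite <- (Rmult_1_l (/ quotients M p)).
      apply Rmult_le_compat.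
      + apply Rlt_le, Rinv_0_lt_compat, INR_S_pos.
      + apply Rlt_le, Hip.
      + rewrite <- Rinv_1. apply Rinv_le_contravar; [lra|]. apply (le_INR 1). lia.
      + apply Hm. lia.
    - apply Rmult_le_compat_r; [lra|]. now apply le_INR. }
  destruct (Nat.le_gt_cases n P) as [Hn|Hn].
  - specialize (Hfirst n Hn). nra.
  - replace n with (P + (n - P))%nat by lia. rewrite block_sum_add.
    specialize (Hfirst P (le_n P)).
    assert (K := HA (n - P)%nat (p + P)%nat ltac:(lia)).
    pose proof (Hm p (p + P)%nat ltac:(lia)). nra.
Qed.

(** Each of the [j] dyadic blocks between [p] and [2^j p] contributes at least half the inverse of
    the quotient at [2^j p]. Comparing with the bound of (snq) for [j >= 4 B] gives the doubling,
    with [N = 2^j]. *)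
Lemma growth_of_snq (M : nat -> R) : weight_sequence M -> snq M -> quotient_growth M.
Proof.
  intros HM HS. apply (snq_block_sum M HM) in HS. destruct HS as [B [HB H]].
  pose proof (fun p => quotients_pos M p HM) as Hpos.
  assert (Hm : forall p q, (p <= q)%nat -> / quotients M q <= / quotients M p).
  { intros p q Hpq. apply Rinv_le_contravar; auto. now apply quotients_mono. }
  assert (HA : forall p j, (1 <= p)%nat ->
    INR j / 2 * / quotients M (2 ^ j * p) <= block_sum (snq_term M) p ((2 ^ j - 1) * p)).
  { intros p j Hp. induction j as [|j IH].
    { cbn. lra. }
    assert (Hj : (1 <= 2 ^ j)%nat) by (clear; induction j; cbn; lia).
    replace ((2 ^ S j - 1) * p)%nat with ((2 ^ j - 1) * p + 2 ^ j * p)%nat by (cbn; nia).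
    rewrite block_sum_add.
    replace (p + (2 ^ j - 1) * p)%nat with (2 ^ j * p)%nat by nia.
    assert (K : INR (2 ^ j * p) * (/ INR (2 ^ S j * p) * / quotients M (2 ^ S j * p))
      <= block_sum (snq_term M) (2 ^ j * p) (2 ^ j * p)).
    { apply block_sum_ge. intros k Hk. unfold snq_term. rewrite Rinv_mult.
      apply Rmult_le_compat.
      - apply Rlt_le, Rinv_0_lt_compat, lt_0_INR. cbn. nia.
      - apply Rlt_le, Rinv_0_lt_compat, Hpos.
      - apply Rinv_le_contravar; [apply INR_S_pos|]. apply le_INR. cbn. nia.
      - apply Hm. cbn. nia. }
    replace (INR (2 ^ j * p) * (/ INR (2 ^ S j * p) * / quotients M (2 ^ S j * p)))
      with (/ 2 * / quotients M (2 ^ S j * p)) in K.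
    2:{ replace (2 ^ S j * p)%nat with (2 * (2 ^ j * p))%nat by (cbn; nia).
        rewrite (mult_INR 2). change (INR 2) with 2.
        assert (0 < INR (2 ^ j * p)) by (apply lt_0_INR; nia).
        pose proof (Hpos (2 * (2 ^ j * p))%nat). field. lra. }
    assert (L := Hm (2 ^ j * p)%nat (2 ^ S j * p)%nat ltac:(cbn; nia)).
    rewrite S_INR. pose proof (pos_INR j).
    assert (INR j / 2 * / quotients M (2 ^ S j * p) <= INR j / 2 * / quotients M (2 ^ j * p))
      by (apply Rmult_le_compat_l; lra).
    lra. }
  destruct (nfloor_ex (4 * B)) as [j0 Hj0]; [lra|].
  set (j := S j0). assert (Hj : 4 * B <= INR j) by (unfold j; rewrite S_INR; lra).
  assert (Hj1 : (1 <= 2 ^ j0)%nat) by (clear; induction j0; cbn; lia).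
  exists (2 ^ j)%nat, 1%nat. split; [cbn; lia|]. split; [lia|].
  intros p Hp. specialize (HA p j Hp). specialize (H p ((2 ^ j - 1) * p)%nat).
  assert (K := Rle_trans _ _ _ HA H).
  pose proof (Hpos p) as Q1. pose proof (Hpos (2 ^ j * p)%nat) as Q2.
  set (x := quotients M p) in *. set (y := quotients M (2 ^ j * p)) in *.
  apply Rmult_le_compat_r with (r := x * y) in K; [|nra].
  replace (INR j / 2 * / y * (x * y)) with (INR j / 2 * x) in K by (field; lra).
  replace (B / x * (x * y)) with (B * y) in K by (field; lra).
  apply Rmult_le_reg_l with B; [easy|]. nra.
Qed.

(** * The growth index and growth of the quotients *)

Lemma Rpower_pos (x y : R) : 0 < Rpower x y.
Proof. apply exp_pos. Qed.

Lemma Rpower_div (x y g : R) : 0 < x -> 0 < y ->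
  Rpower (x / y) g = Rpower x g * Rpower y (- g).
Proof.
  intros Hx Hy. unfold Rdiv. rewrite <- Rpower_mult_distr; auto.
  2:{ now apply Rinv_0_lt_compat. }
  f_equal. unfold Rpower. f_equal. rewrite ln_Rinv by easy. ring.
Qed.

Lemma growth_of_P_index (M : nat -> R) (g : R) : weight_sequence M -> 0 < g ->
  P_index M g -> quotient_growth M.
Proof.
  intros HM Hg (m' & a & Ha & Hcmp & Hinc).
  pose proof (fun p => quotients_pos M p HM) as Hpos.
  assert (Hmono : forall p q, (p <= q)%nat ->
    Rpower (INR (p + 1)) (- g) * m' p <= Rpower (INR (q + 1)) (- g) * m' q).
  { intros p q Hpq. induction Hpq as [|q Hpq IH]; [lra|].
    eapply Rle_trans; [exact IH|]. specialize (Hinc q).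
    replace (q + 2)%nat with (S q + 1)%nat in Hinc by lia.
    now replace (q + 1)%nat with (S q) in Hinc at 2 by lia. }
  (* Passing between [m'] and the quotients twice costs [a * a], so the ratio of [N p + 1] to
     [p + 1], which is at least [N / 2], must have [g]-th power at least [2 * (a * a)]. *)
  set (X := Rpower (2 * (a * a)) (/ g)).
  pose proof (Rpower_pos (2 * (a * a)) (/ g)) as HX. fold X in HX.
  destruct (nfloor_ex (2 * X)) as [n Hn]; [lra|].
  exists (S (S n)), 1%nat. split; [lia|]. split; [lia|]. intros p Hp.
  set (N := S (S n)).
  assert (HN : 2 * X <= INR N) by (unfold N; rewrite !S_INR; lra).
  destruct (Hcmp p Hp) as [C1 _]. destruct (Hcmp (N * p)%nat ltac:(unfold N; nia)) as [_ C2].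
  assert (K := Hmono p (N * p)%nat ltac:(unfold N; nia)).
  set (x := INR (p + 1)) in *. set (y := INR (N * p + 1)) in *.
  assert (Hx : 0 < x) by apply INR_S_pos. assert (Hy : 0 < y) by apply INR_S_pos.
  assert (Hq : X <= y / x).
  { apply Rmult_le_reg_r with x; [easy|].
    unfold Rdiv. rewrite Rmult_assoc, Rinv_l, Rmult_1_r by lra.
    apply Rle_trans with (INR N / 2 * x). { apply Rmult_le_compat_r; lra. }
    unfold x, y. rewrite !plus_INR, mult_INR. change (INR 1) with 1.
    assert (1 <= INR p) by (apply (le_INR 1); lia). nra. }
  assert (HR : 2 * (a * a) <= Rpower (y / x) g).
  { apply Rle_trans with (Rpower X g).
    - unfold X. rewrite Rpower_mult, Rinv_l, Rpower_1 by nra. lra.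
    - apply Rle_Rpower_l; lra. }
  rewrite Rpower_div in HR by easy.
  pose proof (Hpos p) as Q1. pose proof (Hpos (N * p)%nat) as Q2.
  set (u := quotients M p) in *. set (v := quotients M (N * p)) in *.
  pose proof (Rpower_pos x (- g)) as R1. pose proof (Rpower_pos y g) as R2.
  assert (Hinv : Rpower y g * Rpower y (- g) = 1).
  { rewrite <- Rpower_plus, Rplus_opp_r. now apply Rpower_O. }
  apply Rmult_le_compat_l with (r := Rpower y g) in K; [|lra].
  rewrite <- !Rmult_assoc, Hinv, Rmult_1_l in K.
  assert (S1 : 2 * (a * a) * (/ a * u) <= a * v).
  { eapply Rle_trans; [|exact C2]. eapply Rle_trans; [|exact K].
    apply Rmult_le_compat; [nra| |exact HR|exact C1].
    apply Rmult_le_pos; [|lra]. apply Rlt_le, Rinv_0_lt_compat. lra. }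
  replace (2 * (a * a) * (/ a * u)) with (a * (2 * u)) in S1 by (field; lra).
  apply Rmult_le_reg_l with a; lra.
Qed.

(** Each multiplication of the index by [N] doubles both the quotient and the power, since
    [N^g = 2]. The factor [2] on the right pays for the last, incomplete step, where the ratio of
    the indices is at most [N]. *)
Lemma growth_power (M : nat -> R) (N P : nat) (g : R) : weight_sequence M ->
  (2 <= N)%nat -> (1 <= P)%nat -> 0 <= g -> Rpower (INR N) g = 2 ->
  (forall p, (P <= p)%nat -> 2 * quotients M p <= quotients M (N * p)) ->
  forall q p, (P <= q)%nat -> (q <= p)%nat ->
  quotients M q * Rpower (INR p / INR q) g <= 2 * quotients M p.
Proof.
  intros HM HN HP Hg HNg HG.
  assert (HA : forall k q p, (p - q <= k)%nat -> (P <= q)%nat -> (q <= p)%nat ->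
    quotients M q * Rpower (INR p / INR q) g <= 2 * quotients M p).
  2:{ intros q p. apply (HA (p - q)%nat). lia. }
  induction k as [k IH] using (well_founded_induction Wf_nat.lt_wf). intros q p Hk Hq Hqp.
  pose proof (quotients_pos M q HM) as Q1.
  assert (Iq : 0 < INR q) by (apply lt_0_INR; lia).
  assert (Ip : 0 < INR p) by (apply lt_0_INR; lia).
  assert (IN : 0 < INR N) by (apply lt_0_INR; lia).
  destruct (Nat.le_gt_cases p (N * q)) as [Hc|Hc].
  - assert (Rpower (INR p / INR q) g <= 2).
    { rewrite <- HNg. apply Rle_Rpower_l; [easy|]. split; [now apply Rdiv_lt_0_compat|].
      apply Rmult_le_reg_r with (INR q); [easy|].
      unfold Rdiv. rewrite Rmult_assoc, Rinv_l, Rmult_1_r, <- mult_INR by lra. now apply le_INR. }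
    pose proof (quotients_mono M q p HM Hqp). nra.
  - assert (K := IH (p - N * q)%nat ltac:(nia) (N * q)%nat p (le_n _) ltac:(nia) ltac:(lia)).
    specialize (HG q Hq).
    replace (INR p / INR q) with (INR N * (INR p / INR (N * q)))
      by (rewrite mult_INR; field; lra).
    rewrite <- Rpower_mult_distr, HNg; auto.
    2:{ apply Rdiv_lt_0_compat; auto. apply lt_0_INR. nia. }
    pose proof (Rpower_pos (INR p / INR (N * q)) g). nra.
Qed.

Fixpoint running_max (s : nat -> R) (n : nat) : R :=
  match n with
  | O => s O
  | S k => Rmax (running_max s k) (s (S k))
  end.

Lemma running_max_ge (s : nat -> R) (n : nat) : s n <= running_max s n.
Proof. destruct n; cbn; [lra|apply Rmax_r]. Qed.

Lemma running_max_le (s : nat -> R) (n : nat) (c : R) :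
  (forall k, (k <= n)%nat -> s k <= c) -> running_max s n <= c.
Proof.
  induction n as [|n IH]; intros H; cbn.
  - apply H. lia.
  - apply Rmax_lub; [|apply H; lia]. apply IH. intros; apply H. lia.
Qed.

(** The sequence [m'] comes from the least increasing majorant of [m_q (q + 1)^(- g)], multiplied
    back by [(p + 1)^g]. Monotonicity and the lower comparison are then automatic; growth is used to
    bound the majorant from above. *)
Lemma P_index_of_growth (M : nat -> R) : weight_sequence M -> quotient_growth M ->
  exists g, 0 < g /\ P_index M g.
Proof.
  intros HM (N & P & HN & HP & HG).
  pose proof (fun p => quotients_pos M p HM) as Hpos.
  assert (IN : 2 <= INR N) by (apply (le_INR 2); lia).
  assert (HlN : 0 < ln (INR N)) by (rewrite <- ln_1; apply ln_increasing; lra).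
  set (g := ln 2 / ln (INR N)).
  assert (Hg : 0 < g).
  { apply Rdiv_lt_0_compat; [|easy]. rewrite <- ln_1; apply ln_increasing; lra. }
  assert (HNg : Rpower (INR N) g = 2).
  { unfold Rpower, g. replace (ln 2 / ln (INR N) * ln (INR N)) with (ln 2) by (field; lra).
    apply exp_ln. lra. }
  exists g. split; [easy|].
  pose proof (growth_power M N P g HM HN HP (Rlt_le _ _ Hg) HNg HG) as HD.
  set (s := fun q => quotients M q * Rpower (INR (q + 1)) (- g)).
  set (A := 2 * Rpower (INR P + 1) g).
  assert (IP : 1 <= INR P) by (apply (le_INR 1); lia).
  assert (HA1 : 1 <= Rpower (INR P + 1) g).
  { apply Rle_trans with (Rpower (INR P + 1) 0); [rewrite Rpower_O; lra|].
    apply Rle_Rpower; lra. }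
  assert (Hs : forall p q, (q <= p)%nat ->
    quotients M q * Rpower (INR (p + 1) / INR (q + 1)) g <= A * quotients M p).
  { intros p q Hqp. pose proof (Hpos q). pose proof (Hpos p).
    pose proof (quotients_mono M q p HM Hqp).
    assert (Ip : 0 <= INR p) by apply pos_INR. assert (Iq : 0 <= INR q) by apply pos_INR.
    assert (Iqp : INR q <= INR p) by now apply le_INR.
    assert (Hdp : forall c, INR p + 1 <= c * (INR q + 1) ->
       Rpower (INR (p + 1) / INR (q + 1)) g <= Rpower c g).
    { intros c Hc. rewrite !plus_INR. change (INR 1) with 1.
      apply Rle_Rpower_l; [lra|]. split; [apply Rdiv_lt_0_compat; lra|].
      apply Rmult_le_reg_r with (INR q + 1); [lra|].
      unfold Rdiv. rewrite Rmult_assoc, Rinv_l; lra. }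
    unfold A.
    (* If [P <= q], the ratio of the shifted indices is at most [p / q]. If [q < P <= p], the
       comparison starts from [P] instead of [q], at the cost of [(P + 1)^g]. If [p < P], that
       factor alone bounds the power. *)
    destruct (Nat.le_gt_cases P q) as [C1|C1]; [|destruct (Nat.le_gt_cases P p) as [C2|C2]].
    - assert (Hq0 : 1 <= INR q) by (apply (le_INR 1); lia).
      specialize (HD q p C1 Hqp).
      specialize (Hdp (INR p / INR q)).
      assert (INR p + 1 <= INR p / INR q * (INR q + 1)).
      { replace (INR p / INR q * (INR q + 1)) with (INR p + INR p / INR q) by (field; lra).
        assert (1 <= INR p / INR q); [|lra].
        apply Rmult_le_reg_r with (INR q); [lra|].
        unfold Rdiv. rewrite Rmult_assoc, Rinv_l; lra. }
      specialize (Hdp H2).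
      apply Rle_trans with (2 * quotients M p); [|nra].
      eapply Rle_trans; [|exact HD]. apply Rmult_le_compat_l; lra.
    - assert (Hp0 : INR P <= INR p) by now apply le_INR.
      specialize (HD P p (le_n P) C2).
      specialize (Hdp ((INR P + 1) * (INR p / INR P))).
      assert (INR p + 1 <= (INR P + 1) * (INR p / INR P) * (INR q + 1)).
      { apply Rle_trans with ((INR P + 1) * (INR p / INR P) * 1).
        - replace ((INR P + 1) * (INR p / INR P) * 1) with (INR p + INR p / INR P) by (field; lra).
          assert (1 <= INR p / INR P); [|lra].
          apply Rmult_le_reg_r with (INR P); [lra|].
          unfold Rdiv. rewrite Rmult_assoc, Rinv_l; lra.
        - apply Rmult_le_compat_l; [|lra]. apply Rmult_le_pos; [lra|].
          apply Rdiv_le_0_compat; lra. }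
      specialize (Hdp H2).
      rewrite <- Rpower_mult_distr in Hdp by (try apply Rdiv_lt_0_compat; lra).
      pose proof (quotients_mono M q P HM ltac:(lia)).
      pose proof (Rpower_pos (INR p / INR P) g).
      set (r := Rpower (INR (p + 1) / INR (q + 1)) g) in *.
      set (t := Rpower (INR P + 1) g) in *. set (w := Rpower (INR p / INR P) g) in *.
      apply Rle_trans with (quotients M q * (t * w)). { apply Rmult_le_compat_l; lra. }
      apply Rle_trans with (t * (quotients M P * w)); [|nra].
      replace (quotients M q * (t * w)) with (t * (quotients M q * w)) by ring.
      apply Rmult_le_compat_l; [lra|]. apply Rmult_le_compat_r; lra.
    - assert (INR p <= INR P) by (apply le_INR; lia).
      specialize (Hdp (INR P + 1)).
      assert (INR p + 1 <= (INR P + 1) * (INR q + 1)) by nra.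
      specialize (Hdp H3).
      pose proof (Rpower_pos (INR (p + 1) / INR (q + 1)) g).
      apply Rle_trans with (quotients M p * Rpower (INR P + 1) g).
      + apply Rmult_le_compat; lra.
      + nra. }
  assert (Hinv : forall p, Rpower (INR (p + 1)) g * Rpower (INR (p + 1)) (- g) = 1).
  { intros p. rewrite <- Rpower_plus, Rplus_opp_r. apply Rpower_O, INR_S_pos. }
  exists (fun p => Rpower (INR (p + 1)) g * running_max s p), A.
  split; [unfold A; lra|]. split.
  - intros p _. pose proof (Rpower_pos (INR (p + 1)) g). pose proof (Hpos p). split.
    + apply Rle_trans with (quotients M p).
      * rewrite <- (Rmult_1_l (quotients M p)) at 2. apply Rmult_le_compat_r; [lra|].
        rewrite <- Rinv_1. apply Rinv_le_contravar; unfold A; lra.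
      * apply Rle_trans with (Rpower (INR (p + 1)) g * s p).
        { unfold s. right. rewrite (Rmult_comm (quotients M p)), <- Rmult_assoc, Hinv. ring. }
        apply Rmult_le_compat_l; [lra|]. apply running_max_ge.
    + apply Rmult_le_reg_l with (Rpower (INR (p + 1)) (- g)); [apply Rpower_pos|].
      rewrite <- Rmult_assoc, (Rmult_comm _ (Rpower _ g)), Hinv, Rmult_1_l.
      apply running_max_le. intros q Hq. specialize (Hs p q Hq).
      rewrite Rpower_div in Hs by apply INR_S_pos. unfold s.
      pose proof (Rpower_pos (INR (p + 1)) (- g)) as R1.
      apply Rmult_le_compat_l with (r := Rpower (INR (p + 1)) (- g)) in Hs; [|lra].
      eapply Rle_trans; [|exact Hs]. right.
      replace (Rpower (INR (p + 1)) (- g) * (quotients M q * (Rpower (INR (p + 1)) g * Rpower (INR (q + 1)) (- g))))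
        with ((Rpower (INR (p + 1)) g * Rpower (INR (p + 1)) (- g)) * (quotients M q * Rpower (INR (q + 1)) (- g)))
        by ring.
      rewrite Hinv. ring.
  - intros p. rewrite <- !Rmult_assoc.
    rewrite (Rmult_comm (Rpower (INR (p + 1)) (- g))), Hinv.
    replace (p + 2)%nat with (p + 1 + 1)%nat by lia.
    rewrite (Rmult_comm (Rpower (INR (p + 1 + 1)) (- g))), Hinv, !Rmult_1_l.
    replace (p + 1)%nat with (S p) by lia. cbn. apply Rmax_l.
Qed.

Lemma gamma_index_pos (M : nat -> R) :
  Rbar_lt (Finite 0) (gamma_index M) <-> exists g, 0 < g /\ P_index M g.
Proof.
  unfold gamma_index. destruct (Lub_Rbar_correct (P_index M)) as [Hub Hlub]. split.
  - intros H. apply NNPP. intros HN.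
    apply (Rbar_lt_not_le _ _ H). apply Hlub. intros g Hg. cbn.
    apply Rnot_lt_le. intros Hpos. apply HN. now exists g.
  - intros [g [Hg HP]]. apply Rbar_lt_le_trans with (Finite g); [exact Hg|].
    now apply Hub.
Qed.

Lemma snq_iff_growth (M : nat -> R) : weight_sequence M -> (snq M <-> quotient_growth M).
Proof.
  intros HM. split; [now apply growth_of_snq | now apply snq_of_growth].
Qed.

Lemma snq_iff_gamma_index (M : nat -> R) : weight_sequence M ->
  (snq M <-> Rbar_lt (Finite 0) (gamma_index M)).
Proof.
  intros HM. rewrite gamma_index_pos, snq_iff_growth by easy. split.
  - now apply P_index_of_growth.
  - intros [g [Hg HP]]. now apply (growth_of_P_index M g).
Qed.

(** * Surjectivity of the Borel map *)

Lemma Cdiff_partial_sum_proj (a : nat -> C) (n : nat) (z : C) :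
  Cdiff (fun w => partial_sum a (proj w) n) z.
Proof.
  assert (Hpow : forall k, Cdiff (fun w => Cpow (proj w) k) z).
  { induction k as [|k IH].
    - exact (Cdiff_const 1%C z).
    - apply (Cdiff_mult proj (fun w => Cpow (proj w) k)); [apply Cdiff_proj|exact IH]. }
  induction n as [|n IH].
  - exact (Cdiff_const 0%C z).
  - apply (Cdiff_plus (fun w => partial_sum a (proj w) n) (fun w => a n * Cpow (proj w) n)%C).
    + exact IH.
    + apply Cdiff_mult; [apply Cdiff_const|apply Hpow].
Qed.

(** * Remainders around an isolated term *)

Lemma partial_sum_gap (a : nat -> C) (z : C) (p q : nat) : (p <= q)%nat ->
  (forall j, (p <= j < q)%nat -> a j = 0%C) -> partial_sum a z q = partial_sum a z p.
Proof.
  intros Hpq. induction Hpq as [|q Hpq IH]; intros H; [easy|].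
  cbn. rewrite IH by (intros; apply H; lia). rewrite (H q) by lia. ring.
Qed.

Lemma weight_ge (M : nat -> R) (p k : nat) : weight_sequence M ->
  M p * quotients M p ^ k <= M (p + k)%nat.
Proof.
  intros HM. pose proof HM as [H0 _]. induction k as [|k IH].
  - rewrite Nat.add_0_r. cbn. lra.
  - rewrite Nat.add_succ_r.
    assert (E : M (S (p + k)) = quotients M (p + k) * M (p + k)%nat).
    { unfold quotients. pose proof (H0 (p + k)%nat). field. lra. }
    rewrite E. cbn.
    replace (M p * (quotients M p * quotients M p ^ k))
      with (quotients M p * (M p * quotients M p ^ k)) by ring.
    apply Rmult_le_compat; auto.
    + apply Rlt_le. now apply quotients_pos.
    + apply Rmult_le_pos; [apply Rlt_le, H0|]. apply pow_le, Rlt_le. now apply quotients_pos.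
    + apply quotients_mono; auto. lia.
Qed.

(** [M (p + k)] is [M p] times the quotients at [p], ..., [p + k - 1]. The bound [u] is taken at
    [p + k] because failure of growth speaks of the quotient at [N p] itself. *)
Lemma weight_le (M : nat -> R) (p k : nat) (u : R) : weight_sequence M ->
  quotients M (p + k) <= u -> M (p + k)%nat <= M p * u ^ k.
Proof.
  intros HM. pose proof HM as [H0 _]. revert u. induction k as [|k IH]; intros u Hu.
  - rewrite Nat.add_0_r. cbn. lra.
  - rewrite Nat.add_succ_r in *.
    pose proof (quotients_mono M (p + k) (S (p + k)) HM ltac:(lia)) as Hm.
    specialize (IH u ltac:(lra)).
    assert (E : M (S (p + k)) = quotients M (p + k) * M (p + k)%nat).
    { unfold quotients. pose proof (H0 (p + k)%nat). field. lra. }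
    rewrite E. cbn. replace (M p * (u * u ^ k)) with (u * (M p * u ^ k)) by ring.
    apply Rmult_le_compat; auto; try lra.
    + apply Rlt_le. now apply quotients_pos.
    + apply Rlt_le, H0.
Qed.

Lemma half_sector_proper (g : R) : 0 < g ->
  proper_subsector (bounded_sector 0 (g / 2) 1) g.
Proof.
  intros Hg. split.
  - exists 0, (g / 2), 1. split; [lra|]. split; [lra|]. intros z. reflexivity.
  - intros [x y] Hz. pose proof PI_RGT_0 as HPI.
    assert (Hgp : 0 < g * PI) by now apply Rmult_lt_0_compat.
    (* The subsector has half-opening [g * PI / 4], so points this close to it stay within
       [g * PI / 2]. *)
    assert (He : 0 < g * PI / 8) by lra.
    destruct (Hz (fun w : C => Rabs (snd w - y) < g * PI / 8)) as [[u v] [Hu [Ht _]]].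
    + exists (mkposreal _ He). intros w [_ Hw]. exact Hw.
    + unfold sector, rarg in *. cbn in *.
      replace (v - 0) with v in Ht by ring.
      replace y with (v + - (v - y)) by ring.
      eapply Rle_lt_trans; [apply Rabs_triang|]. rewrite Rabs_Ropp. lra.
Qed.

Lemma pow_le_base (x y : R) (n : nat) : (1 <= n)%nat -> 0 <= x -> x <= y -> y <= 1 -> x ^ n <= y.
Proof.
  intros Hn Hx Hxy Hy. destruct n as [|n]; [lia|]. cbn.
  assert (0 <= x ^ n <= 1).
  { split; [now apply pow_le|]. rewrite <- (pow1 n). apply pow_incr. lra. }
  nra.
Qed.

(** All bounds are relative to [c], the size of [M p z ^ p] at
    [|z| = 1 / quotients M p]. *)
Lemma expansion_isolated_term_bounds (M : nat -> R) (f : RLog -> C) (a : nat -> C)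
  (p N : nat) (CT A K : R) (z : RLog) :
  weight_sequence M -> (1 <= p)%nat -> (3 <= N)%nat -> 0 < CT -> 0 < A -> 0 < K ->
  (forall j, (p <= j < N * p)%nat -> j <> (2 * p)%nat -> a j = 0%C) ->
  a (2 * p)%nat = RtoC (M (2 * p)%nat) ->
  quotients M (N * p) < 2 * quotients M p ->
  (forall n, Cmod (f z - partial_sum a (proj z) n)%C <= CT * A ^ n * M n * rmod z ^ n) ->
  rmod z <= K / quotients M p ->
  let c := M p / quotients M p ^ p in
  let F := Cmod (f z - partial_sum a (proj z) (2 * p + 1))%C in
  F <= c * (CT * (2 * A * K) ^ (N * p)) /\
  F <= c * (CT * (A * K) ^ p + (2 * K ^ 2) ^ p) /\
  (rmod z = K / quotients M p -> c * (K ^ (2 * p) - CT * (A * K) ^ p) <= F).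
Proof.
  intros HM Hp HN HC HA HK Ha1 Ha2 Hq Hf Hz c F.
  pose proof HM as [H0 _]. pose proof (quotients_pos M p HM) as Hqp.
  set (q := quotients M p) in *.
  assert (Hr : 0 < rmod z) by apply exp_pos.
  assert (Hc : 0 < c). { apply Rdiv_lt_0_compat; auto. now apply pow_lt. }
  assert (Hzp : forall n, rmod z ^ n <= K ^ n / q ^ n).
  { intros n. unfold Rdiv. rewrite <- pow_inv, <- Rpow_mult_distr. apply pow_incr.
    split; [lra|exact Hz]. }
  assert (Hqn : forall n, 0 < q ^ n) by (intros; now apply pow_lt).
  (* The coefficient at [2 p] is the only one in the stretch that may be nonzero. Hence the partial
     sums of orders [p] and [2 p] agree, and so do those of orders [2 p + 1] and [N p]. *)
  assert (S2p : partial_sum a (proj z) (2 * p) = partial_sum a (proj z) p).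
  { apply partial_sum_gap; [lia|]. intros j Hj. apply Ha1; nia. }
  assert (S2p1 : partial_sum a (proj z) (2 * p + 1)
    = (partial_sum a (proj z) p + RtoC (M (2 * p)%nat) * Cpow (proj z) (2 * p))%C).
  { replace (2 * p + 1)%nat with (S (2 * p)) by lia.
    change (partial_sum a (proj z) (S (2 * p))) with
      (partial_sum a (proj z) (2 * p) + a (2 * p)%nat * Cpow (proj z) (2 * p))%C.
    now rewrite S2p, Ha2. }
  assert (SNp : partial_sum a (proj z) (N * p) = partial_sum a (proj z) (2 * p + 1)).
  { apply partial_sum_gap; [nia|]. intros j Hj. apply Ha1; lia. }
  set (t := Cmod (RtoC (M (2 * p)%nat) * Cpow (proj z) (2 * p))%C).
  assert (Et : t = M (2 * p)%nat * rmod z ^ (2 * p)).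
  { unfold t. rewrite Cmod_mult, Cmod_R, Cmod_pow, Cmod_proj.
    rewrite Rabs_pos_eq; [easy|apply Rlt_le, H0]. }
  assert (Hfp : Cmod (f z - partial_sum a (proj z) p)%C <= c * (CT * (A * K) ^ p)).
  { eapply Rle_trans; [apply Hf|].
    apply Rle_trans with (CT * A ^ p * M p * (K ^ p / q ^ p)).
    - apply Rmult_le_compat_l; [|apply Hzp].
      pose proof (H0 p). pose proof (pow_lt A p HA).
      apply Rmult_le_pos; [apply Rmult_le_pos|]; lra.
    - right. unfold c. rewrite Rpow_mult_distr. unfold Rdiv. ring. }
  split; [|split].
  - unfold F. rewrite <- SNp. eapply Rle_trans; [apply Hf|].
    (* Failure of growth enters here: the powers of [q] cancel against those from [rmod z], and only
       powers of constants remain beside [c]. *)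
    assert (HMN : M (N * p)%nat <= M p * (2 * q) ^ ((N - 1) * p)).
    { replace (N * p)%nat with (p + (N - 1) * p)%nat by nia. apply weight_le; auto.
      replace (p + (N - 1) * p)%nat with (N * p)%nat by nia. lra. }
    apply Rle_trans with (CT * A ^ (N * p) * (M p * (2 * q) ^ ((N - 1) * p)) * (K ^ (N * p) / q ^ (N * p))).
    { assert (0 < CT * A ^ (N * p)) by (apply Rmult_lt_0_compat; auto using pow_lt).
      apply Rmult_le_compat; auto.
      - apply Rmult_le_pos; [lra|apply Rlt_le, H0].
      - apply pow_le; lra.
      - apply Rmult_le_compat_l; lra. }
    apply Rle_trans with (CT * A ^ (N * p) * c * 2 ^ (N * p) * K ^ (N * p)).
    2:{ right. rewrite !Rpow_mult_distr. ring. }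
    assert (E : q ^ (N * p) = q ^ p * q ^ ((N - 1) * p)).
    { rewrite <- pow_add. f_equal. nia. }
    rewrite E, Rpow_mult_distr.
    replace (CT * A ^ (N * p) * (M p * (2 ^ ((N - 1) * p) * q ^ ((N - 1) * p))) * (K ^ (N * p) / (q ^ p * q ^ ((N - 1) * p))))
      with (CT * A ^ (N * p) * c * 2 ^ ((N - 1) * p) * K ^ (N * p)).
    2:{ unfold c. field. split; apply Rgt_not_eq; auto; apply Hqn. }
    apply Rmult_le_compat_r; [apply pow_le; lra|].
    apply Rmult_le_compat_l.
    + apply Rmult_le_pos; [|lra]. apply Rmult_le_pos; [lra|]. apply pow_le; lra.
    + apply Rle_pow; [lra|nia].
  - unfold F. rewrite S2p1.
    replace (f z - (partial_sum a (proj z) p + RtoC (M (2 * p)%nat) * Cpow (proj z) (2 * p)))%C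
      with ((f z - partial_sum a (proj z) p) + - (RtoC (M (2 * p)%nat) * Cpow (proj z) (2 * p)))%C by ring.
    eapply Rle_trans; [apply Cmod_triangle|]. rewrite Cmod_opp. fold t.
    rewrite Rmult_plus_distr_l. apply Rplus_le_compat; [exact Hfp|].
    assert (HM2 : M (2 * p)%nat <= M p * (2 * q) ^ p).
    { replace (2 * p)%nat with (p + p)%nat by lia. apply weight_le; auto.
      eapply Rle_trans; [apply (quotients_mono M (p + p) (N * p) HM); nia|]. lra. }
    rewrite Et. apply Rle_trans with (M p * (2 * q) ^ p * (K ^ (2 * p) / q ^ (2 * p))).
    { apply Rmult_le_compat; auto. apply Rlt_le, H0. apply pow_le; lra. }
    right. unfold c. rewrite !Rpow_mult_distr, <- pow_mult.
    replace (q ^ (2 * p)) with (q ^ p * q ^ p) by (rewrite <- pow_add; f_equal; lia).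
    field. apply Rgt_not_eq, Hqn.
  - intros Hz1.
    assert (HM2 : M p * q ^ p <= M (2 * p)%nat).
    { replace (2 * p)%nat with (p + p)%nat by lia. now apply weight_ge. }
    assert (Ht : c * K ^ (2 * p) <= t).
    { rewrite Et, Hz1. unfold Rdiv. rewrite Rpow_mult_distr, pow_inv.
      apply Rle_trans with (M p * q ^ p * (K ^ (2 * p) * / q ^ (2 * p))).
      - right. unfold c.
        replace (q ^ (2 * p)) with (q ^ p * q ^ p) by (rewrite <- pow_add; f_equal; lia).
        field. apply Rgt_not_eq, Hqn.
      - apply Rmult_le_compat_r; [|exact HM2].
        apply Rmult_le_pos; [apply pow_le; lra|]. apply Rlt_le, Rinv_0_lt_compat, Hqn. }
    assert (T : t <= Cmod (f z - partial_sum a (proj z) p)%C + F).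
    { unfold t, F. rewrite S2p1.
      rewrite <- (Cmod_opp (f z - (partial_sum a (proj z) p + _))%C).
      eapply Rle_trans; [|apply Cmod_triangle]. right. f_equal. ring. }
    lra.
Qed.

Lemma exp_pow_nat (x : R) (n : nat) : exp x ^ n = exp (INR n * x).
Proof.
  induction n as [|n IH].
  - cbn. now rewrite Rmult_0_l, exp_0.
  - rewrite S_INR, <- tech_pow_Rmult, IH, <- exp_plus. f_equal. ring.
Qed.

Lemma no_isolated_terms (M : nat -> R) (g : R) (f : RLog -> C) (a : nat -> C) :
  weight_sequence M -> 0 < g -> holomorphic_on (sector g) f -> expansion M g f a ->
  exists n0 : nat, forall p N : nat, (n0 <= p)%nat -> (n0 <= N)%nat ->
    (forall j, (p <= j < N * p)%nat -> j <> (2 * p)%nat -> a j = 0%C) ->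
    a (2 * p)%nat = RtoC (M (2 * p)%nat) ->
    2 * quotients M p <= quotients M (N * p).
Proof.
  intros HM Hg Hhol Hexp. pose proof HM as (H0 & _ & _ & Hlim).
  pose proof PI_RGT_0 as HPI. assert (HgP : 0 < g * PI) by now apply Rmult_lt_0_compat.
  destruct (Hexp _ (half_sector_proper g Hg)) as (CT & A0 & HC & HA0 & Hbd0).
  (* Enlarging the constant makes [A ^ p] at least [1]. *)
  set (A := A0 + 1). assert (HA : 1 < A) by (unfold A; lra).
  assert (Hbd : forall z n, bounded_sector 0 (g / 2) 1 z ->
    Cmod (f z - partial_sum a (proj z) n)%C <= CT * A ^ n * M n * rmod z ^ n).
  { intros z n Hz. eapply Rle_trans; [now apply Hbd0|].
    apply Rmult_le_compat_r; [apply pow_le, Rlt_le, exp_pos|].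
    apply Rmult_le_compat_r; [apply Rlt_le, H0|].
    apply Rmult_le_compat_l; [lra|]. apply pow_incr. unfold A; lra. }
  clearbody A. clear Hbd0 HA0 A0.
  (* This gives [K ^ p >= 2 * CT * A ^ p], so at the radius [K] the isolated term is at least twice
     the bound on the remainder of order [p]. *)
  set (K := (2 * CT + 1) * A). assert (HK : 1 < K) by (unfold K; nra).
  set (de := / (4 * A)).
  assert (Hde : 0 < de) by (apply Rinv_0_lt_compat; lra).
  assert (Hde1 : de < 1) by (unfold de; rewrite <- Rinv_1; apply Rinv_lt_contravar; lra).
  assert (Hde2 : 2 * A * de = / 2) by (unfold de; field; lra).
  set (h := g * PI / 8). assert (Hh : 0 < h) by (unfold h; lra).
  destruct (two_constants (ln de) (ln K) (ln (2 * K)) h) as (C0 & Ea & E0 & Eb & HC0 & HE & HT).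
  { split; apply ln_increasing; lra. }
  { easy. }
  (* [Q] exceeds both bases in the second bound at the outer radius [2 * K]. *)
  set (Q := A * (2 * K) + 2 * (2 * K) ^ 2).
  assert (HQ : 1 < Q) by (unfold Q; nra).
  (* Small enough that two terms of size [eta] give less than the lower bound [/ 2] in the final
     comparison. *)
  set (eta := / (1 + 4 * C0 * (CT + 1))).
  assert (Hden : 0 < 4 * C0 * (CT + 1)) by (repeat apply Rmult_lt_0_compat; lra).
  assert (Heta : 0 < eta) by (apply Rinv_0_lt_compat; lra).
  assert (Heta1 : eta < 1) by (unfold eta; rewrite <- Rinv_1; apply Rinv_lt_contravar; lra).
  assert (Heta2 : C0 * (2 * CT + 1) * eta < / 2).
  { assert ((1 + 4 * C0 * (CT + 1)) * eta = 1) by (unfold eta; field; lra). nra. }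
  (* The parameter of the two-constants theorem will be [la * p], proportional to [p] in order to
     beat [Q ^ p]; [la] solves [Q * exp (la * (Eb - E0)) = eta]. Only afterwards is [N0] chosen, to
     offset the resulting loss on the left side. *)
  set (la := ln (Q / eta) / (E0 - Eb)).
  assert (HQe : 1 < Q / eta).
  { apply Rmult_lt_reg_r with eta; [easy|]. unfold Rdiv. rewrite Rmult_assoc, Rinv_l; lra. }
  assert (Hla : 0 < la).
  { apply Rdiv_lt_0_compat; [|lra]. rewrite <- ln_1. apply ln_increasing; lra. }
  assert (HlaQ : Q * exp (la * (Eb - E0)) = eta).
  { replace (la * (Eb - E0)) with (- ln (Q / eta)) by (unfold la; field; lra).
    rewrite exp_Ropp, exp_ln by lra. field. lra. }
  destruct (half_pow_small (exp (la * (Ea - E0))) eta Heta) as [N0 HN0].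
  apply is_lim_seq_spec in Hlim. destruct (Hlim (2 * K)) as [P0 HP0].
  (* [P0] puts the radius [2 K / m_p] below [1], the radius of the subsector; the [3] ensures
     [p >= 1] and [2 p + 1 <= N p]. *)
  exists (N0 + P0 + 3)%nat. intros p N Hp HN Ha1 Ha2.
  apply Rnot_lt_le. intros Hq.
  specialize (HP0 p ltac:(lia)).
  set (q := quotients M p) in *.
  assert (Hq0 : 0 < q) by lra.
  set (c := M p / q ^ p).
  assert (Hc : 0 < c). { apply Rdiv_lt_0_compat; auto. now apply pow_lt. }
  set (G := fun w : C => (f (w - RtoC (ln q)) - partial_sum a (proj (w - RtoC (ln q))) (2 * p + 1))%C).
  assert (Hrm : forall x y, rmod ((x, y) - RtoC (ln q))%C = exp x / q).
  { intros x y. unfold rmod. cbn. unfold Rdiv.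
    rewrite exp_plus, exp_Ropp, exp_ln by easy. easy. }
  assert (Him : forall x y, rarg ((x, y) - RtoC (ln q))%C = y).
  { intros x y. unfold rarg. cbn. ring. }
  assert (Hsec : forall x y, x <= ln (2 * K) -> - h <= y <= h ->
    bounded_sector 0 (g / 2) 1 ((x, y) - RtoC (ln q))%C).
  { intros x y Hx Hy. unfold bounded_sector. rewrite Hrm, Him. split.
    - rewrite Rminus_0_r. apply Rle_lt_trans with h; [now apply Rabs_le|]. unfold h. lra.
    - apply Rmult_lt_reg_r with q; [easy|]. unfold Rdiv. rewrite Rmult_assoc, Rinv_l by lra.
      apply exp_le_mono in Hx. rewrite exp_ln in Hx by lra. lra. }
  assert (Hb : forall x y K', x <= ln (2 * K) -> - h <= y <= h -> 0 < K' -> exp x <= K' ->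
    Cmod (G (x, y)) <= c * (CT * (2 * A * K') ^ (N * p)) /\
    Cmod (G (x, y)) <= c * (CT * (A * K') ^ p + (2 * K' ^ 2) ^ p) /\
    (exp x = K' -> c * (K' ^ (2 * p) - CT * (A * K') ^ p) <= Cmod (G (x, y)))).
  { intros x y K' Hx Hy HK' Hex.
    destruct (expansion_isolated_term_bounds M f a p N CT A K' ((x, y) - RtoC (ln q))%C)
      as (B1 & B2 & B3); auto; try lia; try lra.
    - rewrite Hrm. apply Rmult_le_compat_r; [|easy]. apply Rlt_le, Rinv_0_lt_compat, Hq0.
    - split; [exact B1|]. split; [exact B2|]. intros E. apply B3. rewrite Hrm, E. reflexivity. }
  assert (Hx0 : ln K <= ln (2 * K)) by (apply Rlt_le, ln_increasing; lra).
  assert (Hxa : ln de <= ln (2 * K)) by (apply Rlt_le, ln_increasing; lra).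
  assert (Hlow : c / 2 <= Cmod (G (ln K, 0))).
  { destruct (Hb (ln K) 0 K Hx0) as (_ & _ & B3); try lra.
    { rewrite exp_ln; lra. }
    specialize (B3 ltac:(rewrite exp_ln; lra)). eapply Rle_trans; [|exact B3].
    apply Rmult_le_compat_l; [lra|].
    replace (2 * p)%nat with (p + p)%nat by lia. rewrite pow_add, Rpow_mult_distr.
    assert (K1 : 1 <= K ^ p) by (apply pow_R1_Rle; lra).
    assert (K2 : (2 * CT + 1) * A ^ p <= K ^ p).
    { unfold K. rewrite Rpow_mult_distr. apply Rmult_le_compat_r; [apply pow_le; lra|].
      rewrite <- (pow_1 (2 * CT + 1)) at 1. apply Rle_pow; [lra|lia]. }
    assert (A1 : 1 <= A ^ p) by (apply pow_R1_Rle; lra).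
    assert (2 * (CT * A ^ p) <= K ^ p) by nra.
    replace (CT * (A ^ p * K ^ p)) with (CT * A ^ p * K ^ p) by ring. nra. }
  assert (Hup : Cmod (G (ln K, 0)) * exp (la * INR p * E0)
    <= C0 * (c * CT * (/ 2) ^ (N * p) * exp (la * INR p * Ea)
             + c * ((CT + 1) * Q ^ p) * exp (la * INR p * Eb))).
  { apply HT.
    - apply Rmult_le_pos; [lra|apply pos_INR].
    - intros x y Hx Hy.
      assert (Hsh : Cdiff (fun w => w - RtoC (ln q))%C (x, y)).
      { apply Cdiff_minus; [apply Cdiff_id|apply Cdiff_const]. }
      apply Cdiff_minus.
      + apply (Cdiff_comp f (fun w => w - RtoC (ln q))%C); [|exact Hsh].
        apply Cdiff_of_ex_derive, Hhol. unfold sector. rewrite Him.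
        apply Rle_lt_trans with h; [now apply Rabs_le|]. unfold h. lra.
      + apply (Cdiff_comp (fun w => partial_sum a (proj w) (2 * p + 1)) (fun w => w - RtoC (ln q))%C);
          [apply Cdiff_partial_sum_proj|exact Hsh].
    - intros y Hy. destruct (Hb (ln de) y de Hxa Hy Hde) as (B1 & _ & _).
      { rewrite exp_ln; lra. }
      rewrite Hde2 in B1. rewrite Rmult_assoc. exact B1.
    - intros x y Hx Hy.
      destruct (Hb x y (2 * K)) as (_ & B2 & _); try lra.
      { rewrite <- (exp_ln (2 * K)) by lra. apply exp_le_mono. lra. }
      eapply Rle_trans; [exact B2|]. apply Rmult_le_compat_l; [lra|].
      assert (0 <= A * (2 * K)) by nra.
      assert (0 <= 2 * (2 * K) ^ 2) by nra.
      assert (Q1 : (A * (2 * K)) ^ p <= Q ^ p) by (apply pow_incr; unfold Q; lra).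
      assert (Q2 : (2 * (2 * K) ^ 2) ^ p <= Q ^ p) by (apply pow_incr; unfold Q; lra).
      nra. }
  assert (Hexpp : forall E, exp (la * INR p * E) = exp (la * (E - E0)) ^ p * exp (la * INR p * E0)).
  { intros E. rewrite exp_pow_nat, <- exp_plus. f_equal. ring. }
  rewrite (Hexpp Ea), (Hexpp Eb) in Hup.
  pose proof (exp_pos (la * INR p * E0)) as HX. set (X := exp (la * INR p * E0)) in *.
  assert (T1 : (/ 2) ^ (N * p) * exp (la * (Ea - E0)) ^ p <= eta).
  { rewrite pow_mult, <- Rpow_mult_distr.
    assert (0 <= (/ 2) ^ N) by (apply pow_le; lra).
    pose proof (exp_pos (la * (Ea - E0))).
    apply pow_le_base; [lia|nra| |lra].
    apply Rle_trans with (exp (la * (Ea - E0)) / 2 ^ N0); [|lra].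
    rewrite pow_inv. unfold Rdiv. rewrite Rmult_comm.
    apply Rmult_le_compat_l; [lra|]. apply Rinv_le_contravar; [apply pow_lt; lra|].
    apply Rle_pow; [lra|lia]. }
  assert (T2 : Q ^ p * exp (la * (Eb - E0)) ^ p <= eta).
  { rewrite <- Rpow_mult_distr, HlaQ. apply pow_le_base; [lia|lra|lra|lra]. }
  set (u := (/ 2) ^ (N * p)) in *. set (v := exp (la * (Ea - E0)) ^ p) in *.
  set (s := Q ^ p) in *. set (t := exp (la * (Eb - E0)) ^ p) in *.
  apply Rmult_le_compat_r with (r := X) in Hlow; [|lra].
  assert (HF : c / 2 * X <= C0 * (CT * (u * v) + (CT + 1) * (s * t)) * (c * X)).
  { eapply Rle_trans; [exact Hlow|]. eapply Rle_trans; [exact Hup|]. right. ring. }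
  replace (c / 2 * X) with (/ 2 * (c * X)) in HF by field.
  apply Rmult_le_reg_r in HF; [|now apply Rmult_lt_0_compat].
  assert (C0 * (CT * (u * v) + (CT + 1) * (s * t)) <= C0 * (2 * CT + 1) * eta).
  { rewrite Rmult_assoc. apply Rmult_le_compat_l; [lra|]. nra. }
  lra.
Qed.

Lemma growth_of_surjective (M : nat -> R) (g : R) : weight_sequence M ->
  S_tilde M g -> quotient_growth M.
Proof.
  intros HM [Hg Hsurj]. apply NNPP. intros HN.
  pose proof HM as [H0 _].
  (* The side conditions are moved under the existential so that choice gives a total function
     [phi]. *)
  assert (Hbad : forall N P : nat, exists p, (2 <= N)%nat -> (1 <= P)%nat ->
    (P <= p)%nat /\ quotients M (N * p) < 2 * quotients M p).
  { intros N P. apply NNPP. intros Hno. apply HN. exists N, P.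
    assert (HNP : (2 <= N)%nat /\ (1 <= P)%nat).
    { split; apply NNPP; intros K; apply Hno; exists 0%nat; intros; lia. }
    destruct HNP as [K1 K2]. split; [easy|]. split; [easy|].
    intros p Hp. apply Rnot_lt_le. intros K. apply Hno. exists p. auto. }
  pose (phi := fun N P => proj1_sig (constructive_indefinite_description _ (Hbad N P))).
  assert (Hphi : forall N P, (2 <= N)%nat -> (1 <= P)%nat ->
    (P <= phi N P)%nat /\ quotients M (N * phi N P) < 2 * quotients M (phi N P)).
  { intros N P. exact (proj2_sig (constructive_indefinite_description _ (Hbad N P))). }
  clearbody phi.
  (* [s k] violates growth for the factor [k + 3], and [s (S k)] is sought only beyond the stretch
     of [s k], so the stretches do not overlap. *)
  pose (s := fix s k := match k with O => phi 3%nat 1%nat | S i => phi (i + 4)%nat ((i + 3) * s i)%nat end).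
  assert (Hs1 : forall k, (1 <= s k)%nat /\ quotients M ((k + 3) * s k) < 2 * quotients M (s k)).
  { induction k as [|k [IH _]].
    - apply (Hphi 3%nat 1%nat); lia.
    - destruct (Hphi (k + 4)%nat ((k + 3) * s k)%nat ltac:(lia) ltac:(nia)) as [K1 K2].
      change (s (S k)) with (phi (k + 4)%nat ((k + 3) * s k)%nat).
      split; [nia|]. replace (S k + 3)%nat with (k + 4)%nat by lia. exact K2. }
  assert (Hs2 : forall k, ((k + 3) * s k <= s (S k))%nat).
  { intros k. destruct (Hs1 k) as [K1 _].
    apply (Hphi (k + 4)%nat ((k + 3) * s k)%nat); [lia|nia]. }
  assert (Hmono : forall i k, (i <= k)%nat -> (s i <= s k)%nat).
  { intros i k Hik. induction Hik as [|k Hik IH]; [lia|].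
    pose proof (Hs2 k). destruct (Hs1 k). nia. }
  assert (Hge : forall k, (k <= s k)%nat).
  { induction k as [|k IH]; [lia|]. pose proof (Hs2 k). destruct (Hs1 k). nia. }
  clearbody s.
  pose (a := fun j => if excluded_middle_informative (exists k, j = (2 * s k)%nat)
    then RtoC (M j) else 0%C).
  destruct (Hsurj a) as (f & [Hhol _] & Hexp).
  { exists 1. split; [lra|]. exists 1. intros p. rewrite pow1, Rmult_1_l.
    pose proof (H0 p). unfold a. destruct excluded_middle_informative.
    - rewrite Cmod_R, Rabs_pos_eq by lra. right. field. lra.
    - rewrite Cmod_0. unfold Rdiv. rewrite Rmult_0_l. lra. }
  destruct (no_isolated_terms M g f a HM Hg Hhol Hexp) as [n0 Hn0].
  (* A successor index has a predecessor [n0], whose gap condition keeps the earlier exponents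
     [2 * s k] below [s (S n0)]. *)
  destruct (Hs1 (S n0)) as [K1 K2].
  apply (Rlt_not_le _ _ K2). apply Hn0.
  - pose proof (Hge (S n0)). lia.
  - lia.
  - intros j Hj Hne. unfold a. destruct excluded_middle_informative as [[k ->]|]; [|easy].
    exfalso. destruct (Nat.lt_trichotomy k (S n0)) as [L|[L|L]].
    + pose proof (Hmono k n0 ltac:(lia)). pose proof (Hs2 n0). destruct (Hs1 n0). nia.
    + subst k. lia.
    + pose proof (Hmono (S (S n0)) k ltac:(lia)). pose proof (Hs2 (S n0)). lia.
  - unfold a. destruct excluded_middle_informative as [|Hno]; [easy|].
    exfalso. apply Hno. now exists (S n0).
Qed.

Theorem lemma4p5 (M : nat -> R) (hM : weight_sequence M) :
  ((exists gamma : R, S_tilde M gamma) -> snq M) /\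
  (snq M <-> Rbar_lt (Finite 0) (gamma_index M)).
Proof.
  split.
  - intros [g Hg]. apply snq_of_growth; [easy|]. now apply (growth_of_surjective M g).
  - now apply snq_iff_gamma_index.
Qed.
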